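(* Let $\widetilde y\in(0,1)$ be the unique solution in $(0,1)$ of $\widetilde f(\widetilde y)=0$, where $$\widetilde f(z)=\frac{k_2-K_1}{n_2-n_1}\left[n_2(1-n_1)z^{n_1}+n_1(n_2-1)z^{n_2}\right]-(K_2+k_2-K_1),$$ and let $\widetilde b<\widetilde a$ be defined by $$e^{\widetilde b}=-\frac{(k_2-K_1)n_1n_2}{n_2-n_1}\left[\widetilde y^{\,n_1}-\widetilde y^{\,n_2}\right],\qquad e^{\widetilde a}=\frac{e^{\widetilde b}}{\widetilde y}.$$ Then $\widetilde b<\ln K_2<\widetilde a$, and the function $$\widetilde V^\infty(x)=\begin{cases}K_2-e^x+k_2-K_1,&x<\widetilde b,\\[2pt] \dfrac{k_2-K_1}{n_2-n_1}\left[n_2e^{n_1(x-\widetilde a)}-n_1e^{n_2(x-\widetilde a)}\right],&\widetilde b\le x\le\widetilde a,\\[4pt] k_2-K_1,&x>\widetilde a,\end{cases}$$ is a strong solution of the uncapped stationary put-side problem on $\mathbb R$ with obstacle $\psi_2$. If $\widetilde b\ge\ln k_2$, then the restriction of $\widetilde V^\infty$ to $[\ln k_2,\infty)$ is the unique strong solution of the capped stationary put-side problem. If $\widetilde b<\ln k_2$, then the unique strong solution of the capped stationary put-side problem is $$\widetilde V(x)=\begin{cases}\dfrac{k_2-K_1}{n_2-n_1}\left[n_2e^{n_1(x-\widetilde a_c)}-n_1e^{n_2(x-\widetilde a_c)}\right],&\ln k_2\le x\le\widetilde a_c,\\[4pt] k_2-K_1,&x>\widetilde a_c,\end{cases}$$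 where $\widetilde a_c$ is determined by $\widetilde V(\ln k_2)=K_2-K_1$, that is, $e^{\widetilde a_c}=k_2/\widetilde y_c$ with $\widetilde y_c$ the unique root in $(0,1)$ of $$\widetilde g(z)=\frac{k_2-K_1}{n_2-n_1}\left[n_2z^{n_1}-n_1z^{n_2}\right]-(K_2-K_1).$$
   Context: Constants: $0<K_1<k_1<k_2<K_2$, $\sigma>0$, $r>0$, $q\ge0$, and $1<p<\infty$. Put $\mathcal Lu:=\frac{\sigma^2}{2}u''+\left(r-q-\frac{\sigma^2}{2}\right)u'-ru$ and $\psi_2(x):=(K_2-e^x)^++k_2-K_1$. $n_1<0<n_2$ denote the roots of $\frac{\sigma^2}{2}n^2+\left(r-q-\frac{\sigma^2}{2}\right)n-r=0$. A strong solution of the capped stationary put-side problem is a bounded function $V\in C([\ln k_2,\infty))\cap W^2_{p,\mathrm{loc}}((\ln k_2,\infty))$ with $V\ge\psi_2$, $-\mathcal LV\ge0$ almost everywhere, $-\mathcal LV=0$ almost everywhere on $\{V>\psi_2\}$, and $V(\ln k_2)=K_2-K_1$. A strong solution of the uncapped stationary put-side problem is a bounded $V\in C(\mathbb R)\cap W^2_{p,\mathrm{loc}}(\mathbb R)$ satisfying the same obstacle and differential conditions on $\mathbb R$, without boundary condition. *)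

(* Defs.v *)
From HB Require Import structures.
From mathcomp Require Import all_boot all_order all_algebra.
From mathcomp Require Import all_classical all_reals all_analysis.
Set Implicit Arguments.
Unset Strict Implicit.
Unset Printing Implicit Defensive.
Import Order.TTheory GRing.Theory Num.Theory.
Import numFieldNormedType.Exports.
Local Open Scope classical_set_scope.
Local Open Scope ring_scope.

Section Sobolev.
Variable R : realType.
Local Notation mu := (@lebesgue_measure R).

Definition Lp_loc (p : R) (O : set R) (f : R -> R) : Prop :=
  [/\ measurable_fun O f, open O &
      forall K, K `<=` O -> compact K ->
        (\int[mu]_(x in K) (`|f x| `^ p)%:E < +oo)%E].

(* C_c^oo(O); phi is extended by 0 outside O *)
Definition test_function (O : set R) (phi : R -> R) : Prop :=
  [/\ forall n x, derivable (derive1n n phi) x 1,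
      compact (closure [set x | phi x != 0]) &
      closure [set x | phi x != 0] `<=` O].

Definition weak_derivative (n : nat) (O : set R) (u v : R -> R) : Prop :=
  [/\ locally_integrable O u, locally_integrable O v &
      forall phi, test_function O phi ->
        \int[mu]_(x in O) (u x * derive1n n phi x) =
        (-1) ^+ n * \int[mu]_(x in O) (v x * phi x)].

(* u \in W^2_{p,loc}(O), with Du and D2u as versions of its weak derivatives
   (these are determined by u up to a null subset of O) *)
Definition W2p_loc (p : R) (O : set R) (u Du D2u : R -> R) : Prop :=
  [/\ Lp_loc p O u,
      weak_derivative 1 O u Du /\ Lp_loc p O Du &
      weak_derivative 2 O u D2u /\ Lp_loc p O D2u].

End Sobolev.

Section ObstacleProblem.
Variable R : realType.
Local Notation mu := (@lebesgue_measure R).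
Variables (sigma r q : R).

Definition generator (V DV D2V : R -> R) (x : R) : R :=
  sigma ^+ 2 / 2 * D2V x + (r - q - sigma ^+ 2 / 2) * DV x - r * V x.

(* D is the set where V is continuous and bounded, O the open set where the
   variational inequality is posed; values of V outside D are irrelevant *)
Definition strong_obstacle_solution (p : R) (D O : set R) (psi V : R -> R)
    : Prop :=
  [/\ [bounded V x | x in D],
      {within D, continuous V},
      forall x, D x -> psi x <= V x &
      exists DV D2V : R -> R,
        [/\ W2p_loc p O V DV D2V,
            {ae mu, forall x, O x -> 0 <= - generator V DV D2V x} &
            {ae mu, forall x, O x -> psi x < V x ->
               - generator V DV D2V x = 0}]].

End ObstacleProblem.

Section PutSide.
Variable R : realType.
Variables (sigma r q K1 k2 K2 : R).

Definition psi2 (x : R) : R := Num.max (K2 - expR x) 0 + k2 - K1.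

Definition uncapped_put_solution (p : R) (V : R -> R) : Prop :=
  strong_obstacle_solution sigma r q p setT setT psi2 V.

Definition capped_put_solution (p : R) (V : R -> R) : Prop :=
  strong_obstacle_solution sigma r q p `[ln k2, +oo[ `]ln k2, +oo[ psi2 V
  /\ V (ln k2) = K2 - K1.

(* uniqueness as functions on [ln k2, +oo[ *)
Definition unique_capped_put_solution (p : R) (V : R -> R) : Prop :=
  capped_put_solution p V /\
  forall W, capped_put_solution p W -> {in `[ln k2, +oo[, W =1 V}.

Variables (n1 n2 : R).

Definition f_tilde (z : R) : R :=
  (k2 - K1) / (n2 - n1) *
    (n2 * (1 - n1) * z `^ n1 + n1 * (n2 - 1) * z `^ n2) - (K2 + k2 - K1).

Definition g_tilde (z : R) : R :=
  (k2 - K1) / (n2 - n1) * (n2 * z `^ n1 - n1 * z `^ n2) - (K2 - K1).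

Definition continuation_value (a x : R) : R :=
  (k2 - K1) / (n2 - n1) *
    (n2 * expR (n1 * (x - a)) - n1 * expR (n2 * (x - a))).

Definition V_tilde_infty (b a x : R) : R :=
  if x < b then K2 - expR x + k2 - K1
  else if x <= a then continuation_value a x
  else k2 - K1.

(* only meant for x >= ln k2 *)
Definition V_tilde (a x : R) : R :=
  if x <= a then continuation_value a x else k2 - K1.

End PutSide.

Definition unique_root_in01 (R : realType) (f : R -> R) (y : R) : Prop :=
  [/\ 0 < y < 1, f y = 0 & forall z, 0 < z < 1 -> f z = 0 -> z = y].

(* Main.v *)
Require Import Defs.
From HB Require Import structures.
From mathcomp Require Import all_boot all_order all_algebra.
From mathcomp Require Import all_classical all_reals all_analysis.
From mathcomp Require Import measurable_realfun.
From mathcomp Require Import ring lra.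
Set Implicit Arguments.
Unset Strict Implicit.
Unset Printing Implicit Defensive.
Import Order.TTheory GRing.Theory Num.Theory.
Import numFieldNormedType.Exports.
Local Open Scope classical_set_scope.
Local Open Scope ring_scope.

(* With A = e^(n1 rho), B = e^(n2 rho) and tau the translation by rho, a bump
   eta is the datum of a nonnegative compactly supported solution phi of
   (D + n1)(D + n2) phi = (A - tau)(B - tau) eta.  The formal adjoint of the
   generator is (sigma^2/2)(D + n1)(D + n2), so pairing phi with a weak
   subsolution u having a positive maximum M at the center of tau eta, with eta
   narrow, gives 0 <= M (1 + A B - k (A + B)) for k close to 1, which is absurd
   since (1 - A)(1 - B) < 0.  This is a maximum principle which uses only test
   functions and the continuity of u; applied to the difference of two bounded
   solutions minus a small multiple of e^(n2 x), it gives uniqueness.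

   For existence, the candidates are sums of functions which are C^2 to the
   right of a free boundary, vanish there to first order and are cut off to its
   left, hence have bounded piecewise continuous second weak derivatives.  On
   the obstacle side, smooth fit at b and the convexity of the continuation
   value put it above the exercise value K2 - e^x + k2 - K1 to the right of b,
   and give the sign of the generator to the left of b. *)

(** * Differentiability of every order and its closure properties *)

Section Smooth.
Variable R : realType.
Implicit Types (f g : R -> R) (n : nat).

(** Recursing on the function, instead of quantifying over [derive1n], lets stability under sums and
    products go by induction on the order, for all functions at once. *)
Fixpoint differentiable_n n f : Prop :=
  if n is m.+1 then (forall x, derivable f x 1) /\ differentiable_n m (derive1 f)
  else True.

Definition smooth f := forall n, differentiable_n n f.

Lemma smooth_derivable1n f n x : smooth f -> derivable (derive1n n f) x 1.
Proof.
elim: n f => [|n IH] f sf; first by have [+ _] := sf 1; exact.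
by rewrite derive1Sn; apply: IH => m; have [] := sf m.+1.
Qed.

Lemma is_deriveD_fun f g (x a b : R) : is_derive x (1 : R) f a ->
  is_derive x (1 : R) g b -> is_derive x (1 : R) (fun y => f y + g y) (a + b).
Proof. by move=> df dg; exact: is_deriveD. Qed.

Lemma is_deriveM_fun f g (x a b : R) : is_derive x (1 : R) f a ->
  is_derive x (1 : R) g b ->
  is_derive x (1 : R) (fun y => f y * g y) (a * g x + f x * b).
Proof.
move=> df dg; have := is_deriveM df dg.
by rewrite /GRing.scale/= addrC [g x * a]mulrC.
Qed.

Lemma is_deriveB_fun f g (x a b : R) : is_derive x (1 : R) f a ->
  is_derive x (1 : R) g b -> is_derive x (1 : R) (fun y => f y - g y) (a - b).
Proof. by move=> df dg; exact: is_deriveB. Qed.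

Lemma is_deriveZ_fun f (c x a : R) : is_derive x (1 : R) f a ->
  is_derive x (1 : R) (fun y => c * f y) (c * a).
Proof.
move=> df; have := is_deriveM_fun (is_derive_cst c x 1) df.
by rewrite mul0r add0r.
Qed.

Lemma is_derive_comp_fun f g (x a b : R) : is_derive (g x) (1 : R) f a ->
  is_derive x (1 : R) g b -> is_derive x (1 : R) (fun y => f (g y)) (a * b).
Proof. by move=> df dg; exact: (is_derive1_comp df dg). Qed.

Lemma is_derive_derive1 f g :
  (forall x : R, is_derive x (1 : R) f (g x)) -> (derive1 f) = g.
Proof. by move=> fg; apply/funext => x; rewrite derive1E; apply: derive_val. Qed.

Lemma derivable_continuous f : (forall x, derivable f x 1) -> continuous f.
Proof.
by move=> df x; apply: differentiable_continuous; exact/derivable1_diffP.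
Qed.

Lemma is_derive_continuous f g :
  (forall x : R, is_derive x (1 : R) f (g x)) -> continuous f.
Proof. by move=> fg; apply: derivable_continuous => x; have := fg x. Qed.

Lemma is_derive_derive1T f :
  (forall x, derivable f x 1) -> forall x : R, is_derive x (1 : R) f ((derive1 f) x).
Proof. by move=> df x; rewrite derive1E; exact/derivableP. Qed.

Lemma differentiable_nS f g n : (forall x : R, is_derive x (1 : R) f (g x)) ->
  differentiable_n n g -> differentiable_n n.+1 f.
Proof.
move=> fg dg; split; last by rewrite (is_derive_derive1 fg).
by move=> x; have := fg x.
Qed.

Lemma differentiable_nW n f : differentiable_n n.+1 f -> differentiable_n n f.
Proof. by elim: n f => // n IH f [df d1f]; split => //; exact: IH. Qed.

Lemma smoothS f g : (forall x : R, is_derive x (1 : R) f (g x)) ->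
  smooth g -> smooth f.
Proof. by move=> fg sg [//|n]; apply: differentiable_nS fg (sg n). Qed.

Lemma smooth_continuous f : smooth f -> continuous f.
Proof. by move=> /(_ 1) [df _]; exact: derivable_continuous. Qed.

Lemma differentiable_n_cst n (c : R) : differentiable_n n (fun=> c).
Proof.
elim: n c => // n IH c.
by apply: (@differentiable_nS _ (fun=> 0)) => // x; exact: is_derive_cst.
Qed.

Lemma differentiable_nD n f g : differentiable_n n f -> differentiable_n n g ->
  differentiable_n n (fun x => f x + g x).
Proof.
elim: n f g => // n IH f g [df d1f] [dg d1g].
apply: (@differentiable_nS _ (fun x => (derive1 f) x + (derive1 g) x)); last exact: IH.
by move=> x; apply: is_deriveD; exact: is_derive_derive1T.
Qed.

Lemma differentiable_nM n f g : differentiable_n n f -> differentiable_n n g ->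
  differentiable_n n (fun x => f x * g x).
Proof.
elim: n f g => // n IH f g dnf dng.
have [[df d1f] [dg d1g]] := (dnf, dng).
apply: (@differentiable_nS _ (fun x => f x * (derive1 g) x + g x * (derive1 f) x)).
  by move=> x; apply: is_deriveM; exact: is_derive_derive1T.
by apply: differentiable_nD; apply: IH => //; exact: differentiable_nW.
Qed.

Lemma is_derive_affine f (a b x df : R) : is_derive (a * x + b) (1 : R) f df ->
  is_derive x (1 : R) (fun y => f (a * y + b)) (a * df).
Proof.
move=> fdf; rewrite mulrC.
apply: (is_derive_comp_fun (g := fun y => a * y + b)) => //.
have := is_deriveD_fun (is_deriveM_fun (is_derive_cst a x 1) (is_derive_id x 1))
  (is_derive_cst b x 1).
by rewrite /= mul0r add0r mulr1 addr0.
Qed.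

Lemma differentiable_n_affine n f (a b : R) :
  differentiable_n n f -> differentiable_n n (fun x => f (a * x + b)).
Proof.
elim: n f => // n IH f [df d1f].
apply: (@differentiable_nS _ (fun x => a * (derive1 f) (a * x + b))).
  by move=> x; apply: is_derive_affine; exact: is_derive_derive1T.
by apply: differentiable_nM; [exact: differentiable_n_cst|exact: IH].
Qed.

Lemma smoothD f g : smooth f -> smooth g -> smooth (fun x => f x + g x).
Proof. by move=> sf sg n; exact: differentiable_nD. Qed.

Lemma smoothM f g : smooth f -> smooth g -> smooth (fun x => f x * g x).
Proof. by move=> sf sg n; exact: differentiable_nM. Qed.

Lemma smoothZ f (c : R) : smooth f -> smooth (fun x => c * f x).
Proof. by move=> sf; apply: smoothM => // n; exact: differentiable_n_cst. Qed.

Lemma smooth_affine f (a b : R) : smooth f -> smooth (fun x => f (a * x + b)).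
Proof. by move=> sf n; exact: differentiable_n_affine. Qed.

Lemma smooth_shift f (a : R) : smooth f -> smooth (fun x => f (x - a)).
Proof.
move=> /(@smooth_affine _ 1 (- a)).
by under eq_fun do rewrite mul1r.
Qed.

Lemma is_derive_shift_fun f (a x df : R) : is_derive (x - a) (1 : R) f df ->
  is_derive x (1 : R) (fun y => f (y - a)) df.
Proof.
have := @is_derive_affine f 1 (- a) x df.
by rewrite !mul1r; under eq_fun do rewrite mul1r.
Qed.

Lemma smooth_expR : smooth (@expR R).
Proof. by elim=> // n IH; apply: differentiable_nS IH => x; exact: is_derive_expR. Qed.

Lemma is_derive_expRZ (l x : R) :
  is_derive x (1 : R) (fun y => expR (l * y)) (l * expR (l * x)).
Proof.
have := @is_derive_affine expR l 0 x (expR (l * x + 0)) (is_derive_expR _).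
rewrite addr0; congr is_derive.
by apply/funext => y; rewrite addr0.
Qed.

Lemma smooth_expRZ (l : R) : smooth (fun x => expR (l * x)).
Proof.
elim=> // n IH; apply: differentiable_nS (is_derive_expRZ l) _.
by apply: differentiable_nM => //; exact: differentiable_n_cst.
Qed.

End Smooth.

(** * Smooth bumps built from $e^{-1/x}$ *)

Section Bump.
Variable R : realType.

(** The classical flat function is the case $k=0$. With the weights $x^{-k}$ the derivative of each
    member is a linear combination of members, so smoothness is one induction over the whole
    family. *)
Definition flat_exp (k : nat) (x : R) : R :=
  if 0 < x then x ^- k * expR (- x^-1) else 0.

(** Raising $y\le e^y$ at $y=1/((k+1)x)$ to the power $k+1$ gives
    $x^{-(k+1)}e^{-1/x}\le(k+1)^{k+1}$. *)
Lemma flat_exp_bound k x : `|flat_exp k x| <= k.+1%:R ^+ k.+1 * `|x|.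
Proof.
rewrite /flat_exp; case: ifPn => [x0|_]; last by rewrite normr0 mulr_ge0 // exprn_ge0.
rewrite ger0_norm ?mulr_ge0 ?invr_ge0 ?exprn_ge0 ?expR_ge0 ?(ltW x0) // (gtr0_norm x0).
have h : x^-1 / k.+1%:R <= expR (x^-1 / k.+1%:R).
  by rewrite (le_trans _ (expR_ge1Dx _)) // lerDr.
rewrite mulrC ler_pdivrMr ?exprn_gt0 // -mulrA -exprS expRN.
rewrite invf_ple ?posrE ?expR_gt0 ?mulr_gt0 ?exprn_gt0 // invfM -exprVn -exprVn.
rewrite -[in leRHS](@divfK _ (k.+1%:R) _ x^-1) ?pnatr_eq0 // expRM_natr.
rewrite -exprMn lerXn2r ?nnegrE ?expR_ge0 ?divr_ge0 ?mulr_ge0 ?invr_ge0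
  ?(ltW x0) // mulrC.
exact: h.
Qed.

Lemma is_derive_flat_exp_gt0 k (x : R) : 0 < x ->
  is_derive x (1 : R) (fun y : R => y ^- k * expR (- y^-1))
    (- k%:R * (x ^- k.+1 * expR (- x^-1)) + x ^- k.+2 * expR (- x^-1)).
Proof.
move=> x0.
have dV : is_derive x (1 : R) (fun y : R => y^-1) (- x ^- 2).
  have := is_deriveV (lt0r_neq0 x0) (is_derive_id x 1).
  by rewrite /GRing.scale/= mulr1.
have dE : is_derive x (1 : R) (fun y : R => expR (- y^-1)) (expR (- x^-1) * x ^- 2).
  apply: is_derive_comp_fun.
  by rewrite -[x ^- 2]opprK; exact: is_deriveN.
have dX : is_derive x (1 : R) (fun y : R => y ^- k) (- k%:R * x ^- k.+1).
  rewrite (_ : (fun y : R => y ^- k) = (fun y : R => y^-1) ^+ k); last first.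
    by apply/funext => y; rewrite -exprVn exprfctE.
  apply: is_derive_eq (is_deriveX k dV) _.
  case: k => [|k]; first by rewrite mul0r scale0r oppr0 mul0r.
  by rewrite /GRing.scale/= -!exprVn !exprS; ring.
apply: is_derive_eq (is_deriveM_fun dX dE) _.
by rewrite -!exprVn !exprS; ring.
Qed.

Lemma is_derive_flat_exp k (x : R) :
  is_derive x (1 : R) (flat_exp k) (- k%:R * flat_exp k.+1 x + flat_exp k.+2 x).
Proof.
have [x0|x0|->] := ltgtP x 0.
- apply: (@near_eq_is_derive _ _ _ (fun=> 0)).
    near=> y; rewrite /flat_exp ltNge (_ : y <= 0) //.
    by apply: ltW; near: y; exact: lt_nbhsl.
  by rewrite /flat_exp ltNge (ltW x0) mulr0 addr0; exact: is_derive_cst.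
- apply: (@near_eq_is_derive _ _ _ (fun y : R => y ^- k * expR (- y^-1))).
    by near=> y; rewrite /flat_exp (_ : 0 < y) //; near: y; exact: lt_nbhsr.
  by rewrite /flat_exp x0; exact: is_derive_flat_exp_gt0.
(* At 0 the difference quotient is [flat_exp k.+1 h], which [flat_exp_bound] squeezes between two
   multiples of $|h|$. *)
- have -> : - k%:R * flat_exp k.+1 0 + flat_exp k.+2 0 = 0.
    by rewrite /flat_exp ltxx mulr0 addr0.
  have cv0 : k.+2%:R ^+ k.+2 * `|h| @[h --> (0 : R)^'] --> (0 : R).
    have /continuous_withinNx :
        {for (0 : R), continuous (fun h : R => k.+2%:R ^+ k.+2 * `|h|)}.
      by apply: cvgMr; exact: norm_continuous.
    by rewrite normr0 mulr0.
  have cv : h^-1 *: (flat_exp k (h *: 1 + 0) - flat_exp k 0) @[h --> (0 : R)^']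
      --> (0 : R).
    have cvN : - (k.+2%:R ^+ k.+2 * `|h|) @[h --> (0 : R)^'] --> (0 : R).
      by rewrite -[X in _ --> X]oppr0; exact: cvgN cv0.
    apply: (squeeze_cvgr _ cvN cv0).
    near=> h; rewrite -ler_norml addr0.
    rewrite (_ : flat_exp k 0 = 0) ?subr0; last by rewrite /flat_exp ltxx.
    rewrite (le_trans _ (flat_exp_bound k.+1 h)) // /GRing.scale/= mulr1.
    rewrite /flat_exp; case: ifPn => h0; last by rewrite mulr0.
    by rewrite mulrA exprS invfM.
  apply: DeriveDef; first by apply/cvg_ex; exists 0; exact: cv.
  exact: cvg_lim cv.
Unshelve. all: by end_near. Qed.

Lemma smooth_flat_exp k : smooth (flat_exp k).
Proof.
move=> n; elim: n k => // n IH k.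
apply: differentiable_nS (is_derive_flat_exp k) _.
apply: differentiable_nD => //; apply: differentiable_nM => //.
exact: differentiable_n_cst.
Qed.

Lemma smooth_bump (x0 e : R) : 0 < e -> exists eta : R -> R,
  [/\ smooth eta, forall x, 0 <= eta x,
      forall x, `|x - x0| >= e -> eta x = 0 &
      forall x, `|x - x0| < e -> 0 < eta x].
Proof.
move=> e0.
(* The first factor is positive exactly for $x>x_0-e$, the second exactly for $x<x_0+e$. *)
exists (fun x => flat_exp 0 (1 * x + (e - x0)) * flat_exp 0 (-1 * x + (e + x0))).
have fge0 x : 0 <= flat_exp 0 x.
  by rewrite /flat_exp; case: ifP => // x1; rewrite mulr_ge0 ?expR_ge0 // invr_ge0.
have fgt0 x : 0 < x -> 0 < flat_exp 0 x.
  by move=> x1; rewrite /flat_exp x1 mulr_gt0 ?expR_gt0 // invr_gt0.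
have f0 x : x <= 0 -> flat_exp 0 x = 0 by rewrite /flat_exp leNgt; case: ifP.
split.
- by apply: smoothM; apply: smooth_affine; exact: smooth_flat_exp.
- by move=> x; rewrite mulr_ge0.
- move=> x; rewrite ler_normr => /orP[h|h]; last by rewrite f0 ?mul0r //; lra.
  by rewrite (f0 (-1 * x + _)) ?mulr0 //; lra.
- by move=> x; rewrite ltr_norml => /andP[h1 h2]; rewrite mulr_gt0 // fgt0 //; lra.
Qed.

End Bump.

(** * Test functions, their supports and their derivatives *)

Section TestFunctions.
Variable R : realType.
Local Notation mu := (@lebesgue_measure R).
Implicit Types (f g u v phi : R -> R) (O A : set R).

Lemma bounded_onP A f (C : R) :
  (forall x, A x -> `|f x| <= C) -> [bounded f x | x in A].
Proof.
move=> fC; exists C; split; first exact: num_real.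
by move=> M CM x Ax; rewrite /= (le_trans (fC _ Ax)) // ltW.
Qed.

Lemma bounded_on_bound A f : [bounded f x | x in A] ->
  exists C : R, forall x, A x -> `|f x| <= C.
Proof.
by move=> [M [_ fM]]; exists (M + 1) => x Ax; apply: fM => //; rewrite ltrDl.
Qed.

(** The complement of the closed support is open, so there each derivative is that of a function
    locally equal to 0. *)
Lemma test_function_eq0 O phi n x : test_function O phi ->
  ~ closure [set y | phi y != 0] x -> derive1n n phi x = 0.
Proof.
move=> [_ _ _]; elim: n x => [|n IH] x nx /=.
  by apply/eqP/negPn/negP => px; apply: nx; exact: subset_closure.
rewrite derive1E (@near_eq_derive _ _ _ _ (fun=> 0 : R)) ?derive_cst //.
have : open (~` closure [set y | phi y != 0]).
  by apply: closed_openC; exact: closed_closure.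
by rewrite openE => /(_ x nx); apply: filterS => y; exact: IH.
Qed.

Lemma test_function_eq0_off O phi n x : test_function O phi -> ~ O x ->
  derive1n n phi x = 0.
Proof.
move=> tphi Ox; apply: test_function_eq0 (tphi) _ => xS.
by have [_ _ sO] := tphi; exact/Ox/sO.
Qed.

Lemma test_function_radius O phi : test_function O phi ->
  exists M : R, 0 < M /\ forall n x, M < `|x| -> derive1n n phi x = 0.
Proof.
move=> tphi; have [_ /compact_bounded/bounded_on_bound[M MS] _] := tphi.
exists (`|M| + 1); split => [|n x Mx]; first by rewrite ltr_wpDl.
apply: test_function_eq0 tphi _ => /MS; rewrite leNgt => /negP; apply.
by rewrite (le_lt_trans (ler_norm M)) // (lt_trans _ Mx) // ltrDl.
Qed.

Lemma test_function_is_derive O phi n (x : R) : test_function O phi ->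
  is_derive x (1 : R) (derive1n n phi) (derive1n n.+1 phi x).
Proof. by move=> [dphi _ _]; apply: is_derive_derive1T => y; exact: dphi. Qed.

Lemma test_function_continuous O phi n :
  test_function O phi -> continuous (derive1n n phi).
Proof. by move=> [+ _ _] => /(_ n); exact: derivable_continuous. Qed.

Lemma test_functionW O A phi : A `<=` O -> test_function A phi ->
  test_function O phi.
Proof. by move=> AO [? ? phiA]; split => //; exact: subset_trans AO. Qed.

Lemma test_function_derive1 O phi : test_function O phi ->
  test_function O (derive1 phi).
Proof.
move=> tphi; have [sphi cphi phiO] := tphi.
have sub : closure [set x | derive1 phi x != 0] `<=` closure [set x | phi x != 0].
  rewrite [X in _ `<=` X](closure_id _).1; last exact: closed_closure.
  apply: closureS => x /= /eqP d0; apply: contrapT => nx; apply: d0.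
  exact: (test_function_eq0 1 tphi nx).
split.
- by move=> n x; rewrite -derive1Sn.
- by apply: subclosed_compact sub => //; exact: closed_closure.
- exact: subset_trans phiO.
Qed.

Lemma smooth_test_function O phi (a b : R) : smooth phi ->
  (forall x, ~ a < x < b -> phi x = 0) -> `[a, b] `<=` O ->
  test_function O phi.
Proof.
move=> sphi phi0 abO.
have sub : closure [set x | phi x != 0] `<=` `[a, b].
  rewrite [X in _ `<=` X](closure_id _).1; last exact: interval_closed.
  apply: closureS => x /= /eqP p0; apply: contrapT => nx; apply: p0.
  apply: phi0 => /andP[ax xb]; apply: nx.
  by rewrite /= in_itv/= !ltW.
split.
- by move=> n x; exact: smooth_derivable1n.
- apply: subclosed_compact sub; first exact: closed_closure.
  exact: segment_compact.
- exact: subset_trans abO.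
Qed.

End TestFunctions.

(** * Integrability against test functions, and locally bounded functions *)

Section Integrability.
Variable R : realType.
Local Notation mu := (@lebesgue_measure R).
Implicit Types (f g u v phi : R -> R) (O A K : set R).

Lemma eq_integrable_fun A f g : measurable A -> (forall x, A x -> f x = g x) ->
  mu.-integrable A (EFin \o f) -> mu.-integrable A (EFin \o g).
Proof.
move=> mA fg; apply: eq_integrable => // x; rewrite inE => Ax /=.
by rewrite fg.
Qed.

(** On the compact support of [phi], [u] is integrable and the derivative is bounded; elsewhere in
    [O] the product is 0. *)
Lemma integrable_test O u phi n : locally_integrable O u ->
  test_function O phi ->
  mu.-integrable O (EFin \o (fun x => u x * derive1n n phi x)).
Proof.
move=> [mu_u oO iu] tphi; have [_ cK KO] := tphi.
set K := closure _ in cK KO.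
have mK : measurable K by exact: compact_measurable.
have mO : measurable O by exact: open_measurable.
have iK : mu.-integrable K (EFin \o u).
  apply/integrableP; split; last exact: iu.
  by apply/measurable_EFinP; apply: measurable_funS mu_u.
have mphi : measurable_fun K (derive1n n phi).
  apply: measurable_funTS; apply: continuous_measurable_fun.
  exact: test_function_continuous tphi.
have bphi : [bounded derive1n n phi x | x in K].
  have cphi := continuous_subspaceT (test_function_continuous (n := n) tphi) (A := K).
  have /compact_bounded/bounded_on_bound[C hC] := continuous_compact cphi cK.
  by apply: (@bounded_onP _ _ _ C) => x Kx; apply: hC; exists x.
have iKp : mu.-integrable K (EFin \o (fun x => u x * derive1n n phi x)).
  have : mu.-integrable K ((EFin \o u) \* (EFin \o derive1n n phi))%E.
    exact: integrableMl.
  by apply: eq_integrable => // x _ /=; rewrite EFinM.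
have : mu.-integrable O ((EFin \o (fun x => u x * derive1n n phi x)) \_ K).
  apply: (@integrableS _ _ _ _ setT) => //.
  by apply: (iffLR (integrable_mkcond _ _)).
apply: eq_integrable => // x xO; rewrite /patch; case: ifPn => // xK.
rewrite /= (test_function_eq0 n tphi) ?mulr0 //.
by move: xK; rewrite notin_setE.
Qed.

(** This class contains the continuous functions and their truncations at a free boundary, is stable
    under sums, and lies in every [Lp_loc] with nonnegative exponent. *)
Definition locally_bounded_measurable f := measurable_fun setT f /\
  forall N : R, exists C : R, forall x, `|x| <= N -> `|f x| <= C.

Lemma continuous_lbm f : continuous f -> locally_bounded_measurable f.
Proof.
move=> cf; split; first exact: continuous_measurable_fun.
move=> N.
have cfN := continuous_subspaceT cf (A := `[- N, N]).
have /compact_bounded/bounded_on_bound[C hC] :=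
  continuous_compact cfN (@segment_compact _ _ _).
by exists C => x xN; apply: hC; exists x => //=; rewrite in_itv /= -ler_norml.
Qed.

Lemma lbmD f g : locally_bounded_measurable f -> locally_bounded_measurable g ->
  locally_bounded_measurable (fun x => f x + g x).
Proof.
move=> [mf bf] [mg bg]; split; first exact: measurable_funD.
move=> N; have [C fC] := bf N; have [D gD] := bg N.
by exists (C + D) => x xN; rewrite (le_trans (ler_normD _ _)) // lerD ?fC ?gD.
Qed.

Lemma lbm_compact_integrable f K : locally_bounded_measurable f -> compact K ->
  mu.-integrable K (EFin \o f).
Proof.
move=> [mf bf] cK; apply: measurable_bounded_integrable.
- exact: compact_measurable.
- exact: compact_finite_measure.
- exact: measurable_funTS.
- have /compact_bounded/bounded_on_bound[N hN] := cK; have [C hC] := bf N.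
  by apply: (@bounded_onP _ _ _ C) => x Kx; apply/hC/hN.
Qed.

Lemma lbm_locally_integrable O f : open O -> locally_bounded_measurable f ->
  locally_integrable O f.
Proof.
move=> oO lf; have [mf _] := lf; split => //; first exact: measurable_funTS.
move=> K _ cK; have /integrableP[_] := lbm_compact_integrable lf cK.
exact.
Qed.

Lemma lbm_Lp_loc O f (p : R) : open O -> 0 <= p -> locally_bounded_measurable f ->
  Lp_loc p O f.
Proof.
move=> oO p0 lf; have [mf bf] := lf; split => //; first exact: measurable_funTS.
move=> K _ cK.
have : locally_bounded_measurable (fun x => `|f x| `^ p).
  split.
    apply: (measurableT_comp (measurable_powR _)) => //.
    exact: measurableT_comp.
  move=> N; have [C hC] := bf N; exists (C `^ p) => x xN.
  rewrite ger0_norm ?powR_ge0 // ge0_ler_powR ?nnegrE ?hC //.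
  exact: le_trans (normr_ge0 _) (hC _ xN).
move=> /lbm_compact_integrable/(_ cK)/integrableP[_].
congr (_ < _)%E; apply: eq_integral => x _ /=.
by rewrite ger0_norm ?powR_ge0.
Qed.

End Integrability.

(** * Integration by parts and weak derivatives of functions glued at a point *)

Section WeakDerivatives.
Variable R : realType.
Local Notation mu := (@lebesgue_measure R).
Implicit Types (f g u v phi : R -> R) (O A K : set R).

Lemma is_derive_LRcontinuous f g (a b : R) :
  (forall x : R, is_derive x (1 : R) f (g x)) -> derivable_oo_LRcontinuous f a b.
Proof.
move=> fg; have cf := is_derive_continuous fg; split.
- by move=> x _; have := fg x.
- by apply: cvg_at_right_filter; exact: cf.
- by apply: cvg_at_left_filter; exact: cf.
Qed.

Lemma Rintegral_by_parts_itv f g u v (a b : R) : a < b ->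
  (forall x : R, is_derive x (1 : R) f (g x)) -> continuous g ->
  (forall x : R, is_derive x (1 : R) u (v x)) -> continuous v ->
  f a * u a = 0 -> u b = 0 ->
  \int[mu]_(x in `[a, b]) (f x * v x) = - \int[mu]_(x in `[a, b]) (g x * u x).
Proof.
move=> ab fg cg uv cv fua ub.
rewrite (@Rintegration_by_parts _ f u g v) //.
- by rewrite fua ub mulr0 subrr sub0r.
- exact: continuous_subspaceT.
- exact: is_derive_LRcontinuous fg.
- by move=> x _; rewrite (is_derive_derive1 fg).
- exact: continuous_subspaceT.
- exact: is_derive_LRcontinuous uv.
- by move=> x _; rewrite (is_derive_derive1 uv).
Qed.

Lemma Rintegral_subset A f : (forall x, ~ A x -> f x = 0) ->
  \int[mu]_(x in setT) f x = \int[mu]_(x in A) f x.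
Proof.
move=> f0; rewrite [RHS]Rintegral_mkcond; congr (Rintegral _ _ _).
apply/funext => x; rewrite /patch; case: ifPn => // xA; apply: f0.
by move: xA; rewrite notin_setE.
Qed.

(** Adding such a term switches on a correction past the free boundary [b]; every candidate is a
    $C^2$ function plus corrections of this kind. *)
Definition right_part (b : R) f x := if x <= b then 0 else f x.

(** As a composition with a continuous map, the truncation inherits the continuity of [f] without a
    case analysis at [b]. *)
Lemma right_part_max b f : f b = 0 -> right_part b f = f \o (Num.max b).
Proof.
move=> fb; apply/funext => x; rewrite /right_part /=.
by case: (leP x b) => // _; rewrite fb.
Qed.

Lemma right_part_continuous b f : continuous f -> f b = 0 ->
  continuous (right_part b f).
Proof.
move=> cf fb; rewrite right_part_max // => x; apply: continuous_comp; last exact: cf.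
by apply: continuous_max; [exact: cst_continuous|exact: cvg_id].
Qed.

Lemma lbm_right_part b f : continuous f -> locally_bounded_measurable (right_part b f).
Proof.
move=> cf; have [mf bf] := continuous_lbm cf; split.
  apply: measurable_fun_ifT => //.
  by apply: measurable_fun_ler => //; exact: measurable_cst.
move=> N; have [C hC] := bf N; exists C => x xN; rewrite /right_part.
case: ifP => _; last exact: hC.
by rewrite normr0; exact: le_trans (normr_ge0 _) (hC _ xN).
Qed.

Lemma Rintegral_right_part b f g (N : R) : continuous f -> continuous g ->
  (forall x, N < x -> g x = 0) ->
  \int[mu]_(x in setT) (right_part b f x * g x) = \int[mu]_(x in `[b, N]) (f x * g x).
Proof.
move=> cf cg gN.
rewrite (@Rintegral_subset `]b, N]); last first.
  move=> x; rewrite /= in_itv/= /right_part => /negP; rewrite negb_and -leNgt -ltNge.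
  by case: ifP => [_ _|_ /= /gN ->]; rewrite ?mul0r ?mulr0.
(* The truncation is 0 at [b] itself while [f b] is arbitrary; passing from []b, N]] to the closed
   interval adds only a null set. *)
rewrite -Rintegral_itv_obnd_cbnd; last first.
  suff /integrableS : mu.-integrable `[b, N] (EFin \o (fun x => f x * g x)).
    by apply => //; apply: subset_itvr; rewrite bnd_simp.
  apply: continuous_compact_integrable; first exact: segment_compact.
  by apply: continuous_subspaceT => x; apply: cvgM; [exact: cf|exact: cg].
apply: eq_Rintegral => x; rewrite inE /= in_itv/= /right_part => /andP[bx _].
by rewrite leNgt bx.
Qed.

(** The boundary term at [b] is assumed to vanish only as a product, which covers both uses: [f]
    vanishing at a free boundary, and [phi] vanishing because [b] lies to the left of its
    support. *)
Lemma right_part_by_parts b f g phi : test_function setT phi ->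
  (forall x : R, is_derive x (1 : R) f (g x)) -> continuous g -> f b * phi b = 0 ->
  \int[mu]_(x in setT) (right_part b f x * derive1 phi x) =
  - \int[mu]_(x in setT) (right_part b g x * phi x).
Proof.
move=> tphi fg cg fb.
have [M [M0 phi0]] := test_function_radius tphi.
(* [N] lies to the right of both [b] and the support of [phi]. *)
pose N := `|b| + M + 1.
have bN : b < N by rewrite /N; have := ler_norm b; lra.
have NM (x : R) : N <= x -> M < `|x|.
  by rewrite /N => h; have := ler_norm x; have := normr_ge0 b; lra.
have cphi n := test_function_continuous (n := n) tphi.
rewrite (@Rintegral_right_part _ _ _ N) ?(@Rintegral_right_part _ g _ N) //.
- apply: Rintegral_by_parts_itv => //.
  + by move=> x; exact: (test_function_is_derive 0 x tphi).
  + exact: (cphi 1%N).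
  + by apply: (phi0 0%N); exact: NM.
- exact: (cphi 0%N).
- by move=> x Nx; apply: (phi0 0%N); apply/NM/ltW.
- exact: is_derive_continuous fg.
- exact: (cphi 1%N).
- by move=> x Nx; apply: (phi0 1%N); apply/NM/ltW.
Qed.

(* Cut to the left of the support of [phi]. *)
Lemma by_parts f g phi : test_function setT phi ->
  (forall x : R, is_derive x (1 : R) f (g x)) -> continuous g ->
  \int[mu]_(x in setT) (f x * derive1 phi x) =
  - \int[mu]_(x in setT) (g x * phi x).
Proof.
move=> tphi fg cg; have [M [M0 phi0]] := test_function_radius tphi.
pose b := - M - 1.
have bM (x : R) : x <= b -> M < `|x|.
  by rewrite /b => h; have := ler_norm (- x); rewrite normrN; lra.
have E h n : \int[mu]_(x in setT) (h x * derive1n n phi x) =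
             \int[mu]_(x in setT) (right_part b h x * derive1n n phi x).
  congr (Rintegral _ _ _); apply/funext => x; rewrite /right_part; case: ifP => // xb.
  by rewrite phi0 ?mulr0 // bM.
rewrite (E f 1%N) (E g 0%N); apply: right_part_by_parts => //.
by rewrite [phi b](phi0 0%N) ?mulr0 //; exact: bM.
Qed.

Lemma Rintegral_derive1_test phi : test_function setT phi ->
  \int[mu]_(x in setT) derive1 phi x = 0.
Proof.
move=> tphi; have := by_parts tphi (fun x : R => is_derive_cst (1 : R) x 1).
under eq_Rintegral do rewrite mul1r.
move=> ->; last exact: cst_continuous.
by under eq_Rintegral do rewrite mul0r; rewrite Rintegral_cst // mul0r oppr0.
Qed.

(** A global form of $W^2_{p,\mathrm{loc}}$ membership that mentions neither [p] nor an open set: it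
    is additive, and one instance serves both the capped and the uncapped problem. *)
Definition regular_W2 u Du D2u :=
  [/\ locally_bounded_measurable u, locally_bounded_measurable Du,
      locally_bounded_measurable D2u &
      forall phi, test_function setT phi ->
      (\int[mu]_(x in setT) (u x * derive1 phi x) =
        - \int[mu]_(x in setT) (Du x * phi x)) /\
      (\int[mu]_(x in setT) (u x * derive1n 2 phi x) =
        \int[mu]_(x in setT) (D2u x * phi x))].

Lemma regular_W2_C2 u Du D2u : (forall x : R, is_derive x (1 : R) u (Du x)) ->
  (forall x : R, is_derive x (1 : R) Du (D2u x)) -> continuous D2u ->
  regular_W2 u Du D2u.
Proof.
move=> du d2u c2; have c1 := is_derive_continuous d2u.
split; try exact: continuous_lbm.
  exact/continuous_lbm/(is_derive_continuous du).
move=> phi tphi; split; first exact: by_parts.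
by rewrite (by_parts (test_function_derive1 tphi) du) // (by_parts tphi d2u) // opprK.
Qed.

(** Contact of first order at [b] kills the boundary terms of both integrations by parts; the second
    derivative may jump there. *)
Lemma regular_W2_right_part b u Du D2u : (forall x : R, is_derive x (1 : R) u (Du x)) ->
  (forall x : R, is_derive x (1 : R) Du (D2u x)) -> continuous D2u ->
  u b = 0 -> Du b = 0 ->
  regular_W2 (right_part b u) (right_part b Du) (right_part b D2u).
Proof.
move=> du d2u c2 ub Dub; have c1 := is_derive_continuous d2u.
split; try exact: lbm_right_part.
  exact/lbm_right_part/(is_derive_continuous du).
move=> phi tphi; split; first by apply: right_part_by_parts; rewrite // ub mul0r.
rewrite (right_part_by_parts (test_function_derive1 tphi) du) ?ub ?mul0r //.
by rewrite (right_part_by_parts tphi d2u) ?Dub ?mul0r // opprK.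
Qed.

Lemma regular_W2D u Du D2u v Dv D2v : regular_W2 u Du D2u -> regular_W2 v Dv D2v ->
  regular_W2 (fun x => u x + v x) (fun x => Du x + Dv x) (fun x => D2u x + D2v x).
Proof.
move=> [u0 u1 u2 iu] [v0 v1 v2 iv]; split; try exact: lbmD.
move=> phi tphi; have [iu1 iu2] := iu _ tphi; have [iv1 iv2] := iv _ tphi.
have add h k n : locally_bounded_measurable h -> locally_bounded_measurable k ->
    \int[mu]_(x in setT) ((h x + k x) * derive1n n phi x) =
    \int[mu]_(x in setT) (h x * derive1n n phi x) +
    \int[mu]_(x in setT) (k x * derive1n n phi x).
  move=> lh lk; under eq_Rintegral do rewrite mulrDl.
  by rewrite RintegralD //; apply: integrable_test => //;
    apply: lbm_locally_integrable => //; exact: openT.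
by rewrite (add _ _ 1%N) // (add _ _ 2%N) // !(add _ _ 0%N) // iu1 iv1 iu2 iv2 opprD.
Qed.

(** A test function on [O] is one on the whole line, and all its derivatives vanish outside [O], so
    the global identities restrict. *)
Lemma regular_W2_loc O u Du D2u (p : R) : open O -> 0 <= p ->
  regular_W2 u Du D2u -> W2p_loc p O u Du D2u.
Proof.
move=> oO p0 [u0 u1 u2 iu].
have restr h n phi : test_function O phi ->
    \int[mu]_(x in O) (h x * derive1n n phi x) =
    \int[mu]_(x in setT) (h x * derive1n n phi x).
  move=> tphi; rewrite (@Rintegral_subset O) // => x Ox.
  by rewrite (test_function_eq0_off n tphi) ?mulr0.
split; first exact: lbm_Lp_loc.
- split; last exact: lbm_Lp_loc.
  split; try exact: lbm_locally_integrable.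
  move=> phi tphi; rewrite (restr Du 0%N phi) // (restr u 1%N phi) // expr1 mulN1r.
  by have [-> _] := iu _ (test_functionW (@subsetT _ O) tphi).
- split; last exact: lbm_Lp_loc.
  split; try exact: lbm_locally_integrable.
  move=> phi tphi; rewrite (restr D2u 0%N phi) // (restr u 2%N phi) //.
  rewrite sqrrN expr1n mul1r.
  by have [_ ->] := iu _ (test_functionW (@subsetT _ O) tphi).
Qed.

End WeakDerivatives.

(** * Compactly supported test functions adapted to the adjoint operator *)

Section GreenTest.
Variable R : realType.
Local Notation mu := (@lebesgue_measure R).
Implicit Types (f g u v phi eta : R -> R) (a b l rho : R).

Lemma is_derive_ge0_homo f g a b : (forall x : R, is_derive x (1 : R) f (g x)) ->
  (forall x, a < x < b -> 0 <= g x) -> a <= b -> f a <= f b.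
Proof.
move=> fg g0 ab; apply: (@ger0_derive1_ndecr _ f a b) => //.
- by move=> x; rewrite in_itv/= (is_derive_derive1 fg); exact: g0.
- exact/continuous_subspaceT/(is_derive_continuous fg).
Qed.

Lemma is_derive_gt0_homo f g a b : (forall x : R, is_derive x (1 : R) f (g x)) ->
  (forall x, a < x < b -> 0 < g x) -> a < b -> f a < f b.
Proof.
move=> fg g0 ab; apply: (@gtr0_derive1_lt_cc _ f a b) => //.
- by move=> x; rewrite in_itv/= (is_derive_derive1 fg); exact: g0.
- exact/continuous_subspaceT/(is_derive_continuous fg).
- by rewrite in_itv/= lexx ltW.
- by rewrite in_itv/= lexx ltW.
Qed.

Lemma supported_antiderivative f a b : a < b -> continuous f ->
  (forall x, 0 <= f x) -> (forall x, ~ a < x < b -> f x = 0) ->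
  exists F : R -> R, [/\ forall x : R, is_derive x (1 : R) F (f x),
    {homo F : x y / x <= y}, forall x, x <= a -> F x = 0 &
    forall x, b <= x -> F x = F b].
Proof.
move=> ab cf f0 fab.
(* Starting at [a - 1] keeps every [x >= a], including [a] itself, strictly inside the range of the
   fundamental theorem of calculus. *)
pose F x := \int[mu]_(t in `[a - 1, x]) f t.
have F0 x : x <= a -> F x = 0.
  move=> xa; rewrite /F -[RHS](mul0r (fine (mu `[a - 1, x]))) -Rintegral_cst //.
  apply: eq_Rintegral => t; rewrite inE /= in_itv/= => /andP[_ tx].
  by rewrite fab // => /andP[]; rewrite ltNge (le_trans tx xa).
have dF (x : R) : is_derive x (1 : R) F (f x).
  have [xa|ax] := ltP x a.
    rewrite fab; last by rewrite ltNge (ltW xa).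
    apply: (@near_eq_is_derive _ _ _ (fun=> 0 : R)).
    by near=> y; rewrite F0 //; apply: ltW; near: y; exact: lt_nbhsl.
  have if1 : mu.-integrable `[a - 1, x + 1] (EFin \o f).
    apply: continuous_compact_integrable; first exact: segment_compact.
    exact: continuous_subspaceT.
  have xx1 : x < x + 1 by lra.
  have a1x : a - 1 < x by lra.
  have [dFx <-] := continuous_FTC1_closed xx1 if1 a1x (cf x).
  by rewrite derive1E; exact/derivableP.
exists F; split => //.
- by move=> x y; apply: is_derive_ge0_homo dF _ => z _.
- move=> x bx; apply/eqP; rewrite eq_le; apply/andP; split; last first.
    by apply: is_derive_ge0_homo dF _ bx => z _.
  rewrite -lerN2.
  apply: (@is_derive_ge0_homo (fun x => - F x) (fun x => - f x) _ _ _ _ bx).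
  by move=> z /andP[bz _]; rewrite fab ?oppr0 // => /andP[_]; rewrite ltNge (ltW bz).
Unshelve. all: by end_near. Qed.

(* [zeta] is [(e^(l rho) - tau)(D + l)^-1 eta], [tau] being translation by
   [rho]: [D + l] is inverted through an antiderivative [F] of
   [x |-> e^(l x) eta x], and applying [e^(l rho) - tau] to the result restores
   a compact support and makes it nonnegative. *)
Lemma smooth_step l rho eta a b : 0 <= rho -> a < b -> smooth eta ->
  (forall x, 0 <= eta x) -> (forall x, ~ a < x < b -> eta x = 0) ->
  exists zeta : R -> R, [/\ smooth zeta, forall x, 0 <= zeta x,
    forall x, ~ a < x < b + rho -> zeta x = 0 &
    forall x : R, is_derive x (1 : R) zeta
      (expR (l * rho) * eta x - eta (x - rho) - l * zeta x)].
Proof.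
move=> rho0 ab seta eta0 etaab.
have sf : smooth (fun x => expR (l * x) * eta x).
  by apply: smoothM => //; exact: smooth_expRZ.
have [||F [dF hF Fa Fb]] := supported_antiderivative ab (smooth_continuous sf).
- by move=> x; rewrite mulr_ge0 ?expR_ge0.
- by move=> x xab; rewrite etaab ?mulr0.
have sF : smooth F := smoothS dF sf.
(* With $G(x)=e^{-lx}F(x)$, which solves $(D+l)G=\eta$, this is $e^{l\rho}G(x)-G(x-\rho)$.
   Monotonicity of [F] gives the sign; constancy of [F] on each side of the support of [eta] makes
   the difference vanish there. *)
exists (fun x => expR (- l * x + l * rho) * (F x - F (x - rho))); split.
- apply: smoothM; first by apply: smooth_affine; exact: smooth_expR.
  apply: smoothD => //; have := smoothZ (-1) (smooth_shift rho sF).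
  by under eq_fun do rewrite mulN1r.
- by move=> x; rewrite mulr_ge0 ?expR_ge0 // subr_ge0 hF // gerBl.
- move=> x xab; suff -> : F x = F (x - rho) by rewrite subrr mulr0.
  have [xa|ax] := leP x a; first by rewrite !Fa //; lra.
  have bx : b + rho <= x by rewrite leNgt; apply/negP => h; apply: xab; rewrite ax.
  by rewrite Fb ?[RHS]Fb //; lra.
- move=> x.
  have dFs := is_derive_shift_fun (dF (x - rho)).
  have dE : is_derive x (1 : R) (fun y => expR (- l * y + l * rho))
      (- l * expR (- l * x + l * rho)) by apply: is_derive_affine.
  apply: is_derive_eq (is_deriveM_fun dE (is_deriveB_fun (dF x) dFs)) _.
  rewrite (_ : expR (l * x) = expR (l * rho) / expR (- l * x + l * rho)); last first.
    by rewrite -expRB; congr expR; ring.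
  rewrite (_ : expR (l * (x - rho)) = (expR (- l * x + l * rho))^-1); last first.
    by rewrite -expRN; congr expR; ring.
  field; exact: lt0r_neq0 (expR_gt0 _).
Qed.

(* [phi] is the image of [eta] under
   [(e^(n1 rho) - tau)(e^(n2 rho) - tau)(D + n1)^-1 (D + n2)^-1]. *)
Lemma green_test n1 n2 rho eta a b : 0 <= rho -> a < b -> smooth eta ->
  (forall x, 0 <= eta x) -> (forall x, ~ a < x < b -> eta x = 0) ->
  exists phi : R -> R, [/\ smooth phi, forall x, 0 <= phi x,
    forall x, ~ a < x < b + rho + rho -> phi x = 0 &
    forall x, derive1n 2 phi x + (n1 + n2) * derive1 phi x + n1 * n2 * phi x =
      expR (n1 * rho) * expR (n2 * rho) * eta x
      - (expR (n1 * rho) + expR (n2 * rho)) * eta (x - rho)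
      + eta (x - rho - rho)].
Proof.
move=> rho0 ab seta eta0 etaab.
have [zeta [szeta zeta0 zetaab dzeta]] := smooth_step n1 rho0 ab seta eta0 etaab.
have abr : a < b + rho by rewrite (lt_le_trans ab) // lerDl.
have [phi [sphi phi0 phiab dphi]] := smooth_step n2 rho0 abr szeta zeta0 zetaab.
exists phi; split => // x.
have d2 := is_deriveB_fun (is_deriveB_fun
  (is_deriveZ_fun (expR (n2 * rho)) (dzeta x)) (is_derive_shift_fun (dzeta (x - rho))))
  (is_deriveZ_fun n2 (dphi x)).
rewrite (_ : derive1n 2 phi x = derive1 (derive1 phi) x) // (is_derive_derive1 dphi).
by rewrite derive1E (@derive_val _ _ _ _ _ _ _ d2); ring.
Qed.

Lemma integrable_testT phi : test_function setT phi ->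
  mu.-integrable setT (EFin \o phi).
Proof.
move=> tphi.
have l1 : locally_integrable setT (fun=> 1 : R).
  by apply: lbm_locally_integrable; [exact: openT|exact/continuous_lbm/cst_continuous].
have := integrable_test 0 l1 tphi.
by apply: eq_integrable_fun => // x _; rewrite mul1r.
Qed.

(** For [l = 0], [smooth_step] provides a test function whose derivative is $\eta-\eta(\cdot-\rho)$,
    and the derivative of a test function has integral 0. *)
Lemma Rintegral_shift rho eta a b : 0 <= rho -> a < b -> smooth eta ->
  (forall x, 0 <= eta x) -> (forall x, ~ a < x < b -> eta x = 0) ->
  \int[mu]_(x in setT) eta (x - rho) = \int[mu]_(x in setT) eta x.
Proof.
move=> rho0 ab seta eta0 etaab.
have [zeta [szeta zeta0 zetaab dzeta]] := smooth_step 0 rho0 ab seta eta0 etaab.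
have tz := smooth_test_function szeta zetaab (@subsetT _ _).
have te := smooth_test_function seta etaab (@subsetT _ _).
have ts : test_function setT (fun x => eta (x - rho)).
  apply: (@smooth_test_function _ _ _ (a + rho) (b + rho)) => //.
    exact: smooth_shift.
  by move=> x xab; apply: etaab => h; apply: xab; lra.
have := Rintegral_derive1_test tz.
rewrite (is_derive_derive1 dzeta).
under eq_Rintegral do rewrite !mul0r expR0 mul1r subr0.
rewrite RintegralB //; try exact: integrable_testT.
by move=> /eqP; rewrite subr_eq0 => /eqP.
Qed.

Lemma Rintegral_bump_gt0 eta a b : a < b -> continuous eta ->
  (forall x, 0 <= eta x) -> (forall x, ~ a < x < b -> eta x = 0) ->
  (forall x, a < x < b -> 0 < eta x) ->
  0 < \int[mu]_(x in setT) eta x.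
Proof.
move=> ab ceta eta0 etaab etagt.
have [F [dF _ _ _]] := supported_antiderivative ab ceta eta0 etaab.
rewrite (@Rintegral_subset _ `[a, b]); last first.
  move=> x xab; apply: etaab => /andP[ax xb]; apply: xab.
  by rewrite /= in_itv/= !ltW.
rewrite /Rintegral (@continuous_FTC2 _ eta F) //.
- by rewrite -EFinB /= subr_gt0; apply: is_derive_gt0_homo dF _ ab => x; exact: etagt.
- exact: continuous_subspaceT.
- exact: is_derive_LRcontinuous dF.
- by move=> x _; rewrite (is_derive_derive1 dF).
Qed.

End GreenTest.

(** * The weak maximum principle *)

Section MaximumPrinciple.
Variable R : realType.
Local Notation mu := (@lebesgue_measure R).
Implicit Types (f g u v w phi eta : R -> R) (c rho : R).

(* [2 / sigma^2] times the formal adjoint of the generator, [n1] and [n2] being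
   the roots of its characteristic polynomial. *)
Definition adjoint (n1 n2 : R) phi (x : R) :=
  derive1n 2 phi x + (n1 + n2) * derive1 phi x + n1 * n2 * phi x.

Lemma integrable_funZ (O : set R) f (k : R) : measurable O ->
  mu.-integrable O (EFin \o f) -> mu.-integrable O (EFin \o (fun x => k * f x)).
Proof.
move=> mO If; have : mu.-integrable O (fun x => k%:E * (EFin \o f) x)%E.
  exact: integrableZl.
by apply: eq_integrable => // x _ /=; rewrite EFinM.
Qed.

Lemma integrable_funD (O : set R) f g : measurable O ->
  mu.-integrable O (EFin \o f) -> mu.-integrable O (EFin \o g) ->
  mu.-integrable O (EFin \o (fun x => f x + g x)).
Proof.
move=> mO If Ig; have : mu.-integrable O ((EFin \o f) \+ (EFin \o g))%E.
  exact: integrableD.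
by apply: eq_integrable => // x _ /=; rewrite EFinD.
Qed.

(** Moving one derivative changes the sign of the first-order term, so $(D+n_1)(D+n_2)$ on [phi]
    becomes $(D-n_1)(D-n_2)$ on [u]. *)
Lemma Rintegral_adjoint O n1 n2 u Du D2u phi :
  weak_derivative 1 O u Du -> weak_derivative 2 O u D2u -> test_function O phi ->
  \int[mu]_(x in O) (u x * adjoint n1 n2 phi x) =
  \int[mu]_(x in O) ((D2u x - (n1 + n2) * Du x + n1 * n2 * u x) * phi x).
Proof.
move=> [lu lDu wDu] [_ lD2u wD2u] tphi.
have mO : measurable O by case: lu => _ oO _; exact: open_measurable.
have iu n := integrable_test n lu tphi.
have iD := integrable_test 0 lDu tphi.
have iD2 := integrable_test 0 lD2u tphi.
have E1 : forall x, u x * adjoint n1 n2 phi x = u x * derive1n 2 phi x +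
    (n1 + n2) * (u x * derive1n 1 phi x) + n1 * n2 * (u x * derive1n 0 phi x).
  by move=> x; rewrite /adjoint /=; ring.
have E2 : forall x, (D2u x - (n1 + n2) * Du x + n1 * n2 * u x) * phi x =
    D2u x * derive1n 0 phi x + - (n1 + n2) * (Du x * derive1n 0 phi x) +
    n1 * n2 * (u x * derive1n 0 phi x).
  by move=> x /=; ring.
under eq_Rintegral do rewrite E1.
under [RHS]eq_Rintegral do rewrite E2.
rewrite !RintegralD ?RintegralZl //; try by
  repeat first [exact: mO | exact: iu | exact: iD | exact: iD2 |
    apply: integrable_funD | apply: integrable_funZ].
rewrite wDu // wD2u // sqrrN !expr1 expr1n mul1r mulN1r /=; ring.
Qed.

(** [f] agrees almost everywhere with its absolute value. Integrability is not at stake: an infinite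
    integral is sent to 0 by [fine]. *)
Lemma Rintegral_ae_ge0 A f : measurable A -> measurable_fun A f ->
  {ae mu, forall x, A x -> 0 <= f x} -> 0 <= \int[mu]_(x in A) f x.
Proof.
move=> mA mf f0.
suff -> : \int[mu]_(x in A) f x = \int[mu]_(x in A) `|f x|.
  by apply: Rintegral_ge0.
congr fine; apply: ae_eq_integral => //.
- exact/measurable_EFinP.
- by apply/measurable_EFinP; exact: measurableT_comp.
- apply: (@filterS _ _ (ae_filter_ringOfSetsType mu) _ _ _ f0) => x fx0 Ax.
  by rewrite ger0_norm // fx0.
Qed.

Lemma green_coefficients (A B : R) : 0 < A < 1 -> 1 < B ->
  exists2 k : R, 0 < k < 1 & 1 + A * B < k * (A + B).
Proof.
move=> /andP[A0 A1] B1.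
have S0 : 0 < A + B by lra.
have TS : 1 + A * B < A + B by nra.
have T0 : 0 < A * B by rewrite mulr_gt0 //; lra.
(* The midpoint between $(1+AB)/(A+B)$ and 1, the former being smaller than 1 because
   $(1-A)(1-B)<0$. *)
exists ((1 + A * B + (A + B)) / (A + B) / 2).
  by rewrite !ltr_pdivrMr // !divr_gt0 //; lra.
by rewrite mulrAC divfK; lra.
Qed.

(* At a positive maximum [x1] of a subsolution [u], pairing [u] with the
   adjoint of [green_test], which is
   [A B eta - (A + B) eta(. - rho) + eta(. - 2 rho)] with the middle bump
   concentrated at [x1], gives a negative number because
   [1 + A B < A + B]. *)
Lemma no_positive_max O n1 n2 u (x1 d : R) : n1 < 0 -> 0 < n2 -> 0 < d -> open O ->
  (forall x, `|x - x1| < d -> O x) -> locally_integrable O u ->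
  {for x1, continuous u} ->
  (forall x, O x -> u x <= u x1) -> 0 < u x1 ->
  (forall phi, test_function O phi -> (forall x, 0 <= phi x) ->
     (forall x, phi x != 0 -> `|x - x1| < d) ->
     0 <= \int[mu]_(x in O) (u x * adjoint n1 n2 phi x)) -> False.
Proof.
move=> n10 n20 d0 oO ballO lu cu umax M0 sub.
set M := u x1 in umax M0.
(* The three bumps are centered at $x_1-\rho$, $x_1$ and $x_1+\rho$ with radius at most $d/3$, so
   everything stays within $2d/3$ of $x_1$. *)
pose rho := d / 3.
have rho0 : 0 < rho by rewrite divr_gt0.
pose A := expR (n1 * rho); pose B := expR (n2 * rho).
have A01 : 0 < A < 1 by rewrite expR_gt0 expR_lt1 pmulr_llt0.
have B1 : 1 < B by rewrite expR_gt1 mulr_gt0.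
have [k /andP[k0 k1] hk] := green_coefficients A01 B1.
have [e e0 ue] : exists2 e : R, 0 < e & forall x, `|x - x1| < e -> k * M < u x.
  have kM : k * M < u x1 by rewrite -[X in _ < X]mul1r ltr_pM2r.
  have /nbhs_ballP[e /= e0 he] : \forall x \near x1, k * M < u x.
    exact: (cvgr_gt (u x1) cu).
  by exists e => // x xe; apply: he; rewrite /ball/= distrC.
pose eps := Num.min e (d / 3).
have eps0 : 0 < eps by rewrite lt_min e0 divr_gt0.
have epse : eps <= e by rewrite ge_min lexx.
have epsd : eps <= d / 3 by rewrite ge_min lexx orbT.
have [eta [seta eta0 etaoff etaon]] := smooth_bump (x1 - rho) eps0.
pose a := x1 - rho - eps; pose b := x1 - rho + eps.
have ab : a < b by rewrite /a /b; lra.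
have supp x : ~ a < x < b -> eta x = 0.
  move=> nab; apply: etaoff; rewrite leNgt; apply/negP; rewrite ltr_norml => h.
  by apply: nab; rewrite /a /b; lra.
have [phi [sphi phi0 phiab Lphi]] := green_test n1 n2 (ltW rho0) ab seta eta0 supp.
have inO x : a <= x <= b + rho + rho -> `|x - x1| < d.
  by rewrite /a /b ltr_norml /rho => h; lra.
have tphi : test_function O phi.
  apply: (smooth_test_function sphi phiab) => x; rewrite /= in_itv/= => h.
  exact/ballO/inO.
have te (s : R) : 0 <= s <= rho + rho -> test_function O (fun x => eta (x - s)).
  move=> s01; apply: (@smooth_test_function _ _ _ (a + s) (b + s)).
  - exact: smooth_shift.
  - by move=> x nx; apply: supp => h; apply: nx; lra.
  - move=> x; rewrite /= in_itv/= => h; apply/ballO/inO; lra.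
have mO : measurable O by exact: open_measurable.
have l1 : locally_integrable O (fun=> 1 : R).
  by apply: lbm_locally_integrable => //; exact/continuous_lbm/cst_continuous.
have ie s : 0 <= s <= rho + rho -> mu.-integrable O (EFin \o (fun x => eta (x - s))).
  move=> /te/(integrable_test 0 l1).
  by apply: eq_integrable_fun => // x _; rewrite mul1r.
have Ie s : 0 <= s <= rho + rho ->
    \int[mu]_(x in O) eta (x - s) = \int[mu]_(x in setT) eta x.
  move=> hs; rewrite -(@Rintegral_subset _ O).
    by apply: Rintegral_shift ab seta eta0 supp; lra.
  by move=> x Ox; apply: (test_function_eq0_off 0 (te s hs) Ox).
have I0 : 0 < \int[mu]_(x in setT) eta x.
  apply: Rintegral_bump_gt0 ab (smooth_continuous seta) eta0 supp _.
  by move=> x; rewrite /a /b => h; apply: etaon; rewrite ltr_norml; lra.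
set I := (\int[mu]_(x in setT) eta x) in I0 Ie.
pose T x := A * B * eta x + - (A + B) * eta (x - rho) + eta (x - rho - rho).
have phiT : adjoint n1 n2 phi = T.
  by apply/funext => x; rewrite /adjoint Lphi /T mulNr.
have tT : test_function O T.
  apply: (@smooth_test_function _ _ _ a (b + rho + rho)).
  - apply: smoothD; last exact: (smooth_shift rho (smooth_shift rho seta)).
    by apply: smoothD; apply: smoothZ => //; exact: smooth_shift.
  - move=> x nx; rewrite /T !supp; first by ring.
    + by move=> h; apply: nx; lra.
    + by move=> h; apply: nx; lra.
    + by move=> h; apply: nx; lra.
  - by move=> x; rewrite /= in_itv/= => h; exact/ballO/inO.
have uT : 0 <= \int[mu]_(x in O) (u x * T x).
  rewrite -phiT; apply: sub => // x px; apply: inO.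
  suff /andP[ax xb] : a < x < b + rho + rho by rewrite !ltW.
  have [//|/negP nx] := boolP (a < x < b + rho + rho).
  by move: px; rewrite phiab ?eqxx.
have hs0 : 0 <= (0 : R) <= rho + rho by lra.
have hs1 : 0 <= rho <= rho + rho by lra.
have hs2 : 0 <= rho + rho <= rho + rho by lra.
(* The outer bumps have positive coefficients and need only [u <= M]; the middle one has a negative
   coefficient and needs the lower bound [k * M], available near [x1] by continuity. *)
have bound : \int[mu]_(x in O) (u x * T x) <= \int[mu]_(x in O)
    (M * A * B * eta (x - 0) + - (k * M * (A + B)) * eta (x - rho) +
     M * eta (x - (rho + rho))).
  apply: le_Rintegral => //.
  - exact: (integrable_test 0 lu tT).
  - by repeat first [exact: mO | exact: ie |
    apply: integrable_funD | apply: integrable_funZ].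
  - move=> x Ox; rewrite /T subr0 (opprD rho rho) (addrA x).
    have /andP[A0 A1] := A01.
    have h1 : u x * (A * B * eta x) <= M * (A * B * eta x).
      by apply: ler_wpM2r; rewrite ?umax // !mulr_ge0 //; lra.
    have h3 : u x * eta (x - rho - rho) <= M * eta (x - rho - rho).
      by apply: ler_wpM2r; rewrite ?umax.
    have h2 : k * M * ((A + B) * eta (x - rho)) <= u x * ((A + B) * eta (x - rho)).
      have [xe|xe] := ltP `|x - x1| eps.
        apply: ler_wpM2r; first by rewrite mulr_ge0 //; lra.
        by apply/ltW/ue; exact: lt_le_trans epse.
      rewrite etaoff ?mulr0 //.
      by rewrite (_ : x - rho - (x1 - rho) = x - x1) //; ring.
    by lra.
move: (le_trans uT bound).
rewrite !RintegralD ?RintegralZl //; try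
  by repeat first [exact: mO | exact: ie |
    apply: integrable_funD | apply: integrable_funZ].
rewrite !Ie // -!mulrDl leNgt => /negP; apply.
rewrite pmulr_llt0 // (_ : _ + _ = M * ((1 + A * B) - k * (A + B))); last by ring.
by rewrite pmulr_rlt0 // subr_lt0.
Qed.

End MaximumPrinciple.

(** * Comparison of two strong solutions on a half-line *)

Section Comparison.
Variable R : realType.
Local Notation mu := (@lebesgue_measure R).

Lemma weak_derivativeB n (O : set R) (u v Du Dv : R -> R) :
  weak_derivative n O u Du -> weak_derivative n O v Dv ->
  weak_derivative n O (fun x => u x - v x) (fun x => Du x - Dv x).
Proof.
move=> [lu lDu wu] [lv lDv wv]; split; try exact: locally_integrableB.
move=> phi tphi.
have mO : measurable O by case: lu => _ oO _; exact: open_measurable.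
under eq_Rintegral do rewrite mulrBl.
under [in RHS]eq_Rintegral do rewrite mulrBl.
have iDu := integrable_test 0 lDu tphi.
have iDv := integrable_test 0 lDv tphi.
rewrite RintegralB //; try exact: integrable_test.
by rewrite wu // wv // RintegralB // mulrBr.
Qed.

Lemma Rintegral_adjoint_ge0 O (n1 n2 : R) (u Du D2u phi : R -> R) :
  weak_derivative 1 O u Du -> weak_derivative 2 O u D2u -> test_function O phi ->
  {ae mu, forall x, O x -> 0 <= (D2u x - (n1 + n2) * Du x + n1 * n2 * u x) * phi x} ->
  0 <= \int[mu]_(x in O) (u x * adjoint n1 n2 phi x).
Proof.
move=> wDu wD2u tphi ge0.
rewrite (Rintegral_adjoint n1 n2 wDu wD2u tphi).
have [[mu_u oO _] [mDu _ _] _] := wDu; have [_ [mD2u _ _] _] := wD2u.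
have mO : measurable O by exact: open_measurable.
apply: Rintegral_ae_ge0 => //.
apply: measurable_funM; last first.
  apply: measurable_funTS; apply: continuous_measurable_fun.
  exact: (test_function_continuous (n := 0) tphi).
apply: measurable_funD; last by apply: measurable_funM => //; exact: measurable_cst.
by apply: measurable_funB => //; apply: measurable_funM => //; exact: measurable_cst.
Qed.

Lemma within_itvcy_continuous (c : R) (f : R -> R) : {within `[c, +oo[, continuous f} ->
  forall x, c < x -> {for x, continuous f}.
Proof.
move=> cf x cx.
have : {within `]c, +oo[, continuous f}.
  by apply: continuous_subspaceW cf; apply: subset_itvr; rewrite bnd_simp.
rewrite continuous_open_subspace; last exact: interval_open.
by apply; rewrite inE /= in_itv/= cx.
Qed.

(* The exponential barrier [d e^(n2 x)], annihilated by the generator, turns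
   the bounded difference into a function attaining its supremum. *)
Lemma strong_obstacle_solution_le (sigma r q p c n1 n2 : R) (psi V W : R -> R) :
  0 < sigma -> n1 < 0 -> 0 < n2 ->
  sigma ^+ 2 / 2 * (n1 + n2) = - (r - q - sigma ^+ 2 / 2) ->
  sigma ^+ 2 / 2 * (n1 * n2) = - r ->
  strong_obstacle_solution sigma r q p `[c, +oo[ `]c, +oo[ psi V ->
  strong_obstacle_solution sigma r q p `[c, +oo[ `]c, +oo[ psi W ->
  V c <= W c -> forall x, c <= x -> V x <= W x.
Proof.
move=> s0 n10 n20 vS vP [bV cV psiV [DV [D2V [[_ [wV1 _] [wV2 _]] _ LV]]]].
move=> [bW cW psiW [DW [D2W [[_ [wW1 _] [wW2 _]] LW _]]]] VWc x0 cx0.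
rewrite leNgt; apply/negP => VW0.
have [C1 hC1] := bounded_on_bound bV; have [C2 hC2] := bounded_on_bound bW.
have inD x : c <= x -> `[c, +oo[%classic x by rewrite /= in_itv/= andbT.
have inO x : c < x -> `]c, +oo[%classic x by rewrite /= in_itv/= andbT.
pose w0 := V x0 - W x0.
have w0gt : 0 < w0 by rewrite subr_gt0.
(* Chosen so that the barrier equals [w0 / 2] at [x0], which leaves the penalized difference
   positive there. *)
pose dl := w0 / 2 / expR (n2 * x0).
have dl0 : 0 < dl by rewrite !divr_gt0 ?expR_gt0.
pose h x := dl * expR (n2 * x).
have dh (x : R) : is_derive x (1 : R) h (n2 * h x).
  apply: is_derive_eq (is_deriveZ_fun dl (is_derive_expRZ n2 x)) _.
  by rewrite /h; ring.
have d2h (x : R) : is_derive x (1 : R) (fun x => n2 * h x) (n2 * (n2 * h x)).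
  exact: is_deriveZ_fun.
have ch : continuous h := is_derive_continuous dh.
have ch2 : continuous (fun x => n2 * (n2 * h x)).
  by move=> x; do 2 (apply: cvgMr); exact: ch.
have oO : open `]c, +oo[%classic by exact: interval_open.
have wh := regular_W2_loc oO ler01 (regular_W2_C2 dh d2h ch2).
pose u x := V x - W x - h x.
have u0 : 0 < u x0.
  rewrite /u -/w0 /h /dl divfK ?gt_eqF ?expR_gt0 //; lra.
have h0 x : 0 < h x by rewrite mulr_gt0 ?expR_gt0.
(* Beyond [X], the inequality $e^{n_2x}\ge1+n_2x$ makes the barrier exceed the bound on [V - W], so
   the supremum is attained on [[c, X]]. *)
pose X := Num.max x0 ((`|C1| + `|C2|) / dl / n2).
have x0X : x0 <= X by rewrite le_max lexx.
have uX x : X <= x -> u x < 0.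
  move=> Xx; have cx : c <= x by rewrite (le_trans cx0) // (le_trans x0X).
  have hx : (`|C1| + `|C2|) / dl / n2 <= x.
    by rewrite (le_trans _ Xx) // le_max lexx orbT.
  have : `|C1| + `|C2| < h x.
    rewrite /h -ltr_pdivrMl // mulrC.
    rewrite ler_pdivrMr // in hx; apply: (le_lt_trans hx).
    by have := expR_ge1Dx (n2 * x); lra.
  have := hC1 x (inD x cx); have := hC2 x (inD x cx).
  have := ler_norm C1; have := ler_norm C2.
  have := ler_norm (V x); have := ler_norm (- W x); rewrite normrN /u; lra.
have cu : {within `[c, X], continuous u}.
  have sub : `[c, X] `<=` `[c, +oo[ by apply: subset_itvl.
  move=> x; apply: cvgB; last exact: (continuous_subspaceT ch).
  apply: cvgB; first exact: (continuous_subspaceW sub cV).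
  exact: (continuous_subspaceW sub cW).
have [x1 x1I umax] := EVT_max (le_trans cx0 x0X) cu.
move: x1I; rewrite in_itv/= => /andP[cx1 x1X].
have M0 : 0 < u x1 by apply: (lt_le_trans u0); apply: umax; rewrite in_itv/= cx0.
have cx1' : c < x1.
  rewrite lt_neqAle cx1 andbT; apply/eqP => E; move: M0; rewrite -E /u.
  by have := h0 c; lra.
have umaxO x : `]c, +oo[%classic x -> u x <= u x1.
  rewrite /= in_itv/= andbT => cx; have [xX|/ltW Xx] := leP x X.
    by apply: umax; rewrite in_itv/= ltW.
  by rewrite (le_trans _ (ltW M0)) // ltW // uX.
have cV1 := within_itvcy_continuous cV cx1'.
have cW1 := within_itvcy_continuous cW cx1'.
have cu1 : {for x1, continuous u} by apply: cvgB; [exact: cvgB|exact: ch].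
(* Near [x1], [V] lies above [W] and hence above the obstacle: there [V] satisfies the equation and
   [W] an inequality, which makes the difference a subsolution. *)
have [d /= d0 hd] : exists2 d : R, 0 < d &
    forall x, `|x - x1| < d -> c < x /\ W x < V x.
  have /nbhs_ballP[d /= d0 hd] : \forall x \near x1, c < x /\ 0 < u x.
    by apply: filterI; [exact: lt_nbhsr|exact: (cvgr_gt (u x1) cu1)].
  exists d => // x xd; have [cx ux] : c < x /\ 0 < u x.
    by apply: hd; rewrite /ball/= distrC.
  by split=> //; move: ux; rewrite /u; have := h0 x; lra.
have [_ [wh1 _] [wh2 _]] := wh.
apply: (no_positive_max n10 n20 d0 oO _ _ cu1 umaxO M0).
- by move=> x /hd[cx _]; exact: inO.
- by have [lu _ _] := weak_derivativeB (weak_derivativeB wV1 wW1) wh1.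
move=> phi tphi phi0 supp.
apply: (Rintegral_adjoint_ge0 (weak_derivativeB (weak_derivativeB wV1 wW1) wh1)
  (weak_derivativeB (weak_derivativeB wV2 wW2) wh2) tphi).
apply: (@filterS2 _ _ (ae_filter_ringOfSetsType mu) _ _ _ _ LV LW) => x LVx LWx Ox.
have [->|phix] := eqVneq (phi x) 0; first by rewrite mulr0.
apply: mulr_ge0 => //; have [cx VWx] := hd x (supp x phix).
have {}LVx : generator sigma r q V DV D2V x = 0.
  apply/eqP; rewrite -oppr_eq0; apply/eqP/LVx => //.
  by apply: le_lt_trans VWx; apply/psiW/inD/ltW.
have {}LWx := LWx Ox.
have s2 : 0 < sigma ^+ 2 / 2 by rewrite divr_gt0 // exprn_gt0.
rewrite -(pmulr_rge0 _ s2); move: LVx LWx; rewrite /generator.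
set DDu := (X in _ -> _ -> 0 <= _ * X).
(* The barrier terms cancel since $n_2^2-(n_1+n_2)n_2+n_1n_2=0$; what remains is a difference of two
   generators by Vieta's formulas. *)
have -> : sigma ^+ 2 / 2 * DDu =
    (sigma ^+ 2 / 2 * D2V x - (sigma ^+ 2 / 2 * (n1 + n2)) * DV x
      + sigma ^+ 2 / 2 * (n1 * n2) * V x)
    - (sigma ^+ 2 / 2 * D2W x - (sigma ^+ 2 / 2 * (n1 + n2)) * DW x
      + sigma ^+ 2 / 2 * (n1 * n2) * W x).
  by rewrite /DDu; ring.
by rewrite vS vP; lra.
Qed.

End Comparison.

(** * From regular candidates to strong solutions *)

Section Assembly.
Variable R : realType.
Local Notation mu := (@lebesgue_measure R).

Lemma ae_neq (a : R) : {ae mu, forall x, x != a}.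
Proof.
exists [set a]; split; first exact: measurable_set1.
  exact: lebesgue_measure_set1.
by move=> x /= /negP; rewrite negbK => /eqP.
Qed.

(** The second derivative of a candidate jumps at its free boundaries [a] and [b]; these form a null
    set, so the pointwise conditions are asked only elsewhere. *)
Lemma regular_strong_obstacle_solution (sigma r q p a b : R) (D O : set R)
    (psi V DV D2V : R -> R) : open O -> 0 <= p ->
  [bounded V x | x in D] -> continuous V -> (forall x, D x -> psi x <= V x) ->
  regular_W2 V DV D2V ->
  (forall x, O x -> x != a -> x != b ->
     generator sigma r q V DV D2V x <= 0 /\
     (psi x < V x -> generator sigma r q V DV D2V x = 0)) ->
  strong_obstacle_solution sigma r q p D O psi V.
Proof.
move=> oO p0 bV cV psiV W2V LV; split => //; first exact: continuous_subspaceT.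
exists DV, D2V; split; first exact: regular_W2_loc.
- apply: (@filterS2 _ _ (ae_filter_ringOfSetsType mu) _ _ _ _ (ae_neq a) (ae_neq b)).
  by move=> x xa xb Ox; rewrite oppr_ge0; have [] := LV x Ox xa xb.
- apply: (@filterS2 _ _ (ae_filter_ringOfSetsType mu) _ _ _ _ (ae_neq a) (ae_neq b)).
  by move=> x xa xb Ox psix; have [_ ->] := LV x Ox xa xb; rewrite ?oppr0.
Qed.

Lemma vieta (s2 be r n1 n2 : R) : n1 < n2 ->
  s2 * n1 ^+ 2 + be * n1 - r = 0 -> s2 * n2 ^+ 2 + be * n2 - r = 0 ->
  s2 * (n1 + n2) = - be /\ s2 * (n1 * n2) = - r.
Proof.
move=> n12 h1 h2.
have S : s2 * (n1 + n2) = - be.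
  apply/eqP; rewrite -subr_eq0 opprK; apply/eqP.
  have nz : n2 - n1 != 0 by rewrite subr_eq0 gt_eqF.
  apply: (mulIf nz); rewrite mul0r -[RHS](subrr 0) -{1}h2 -h1; ring.
split=> //; have -> : s2 * (n1 * n2) = (s2 * (n1 + n2)) * n1 - s2 * n1 ^+ 2 by ring.
by rewrite S; lra.
Qed.

End Assembly.

(** * Monotonicity, convexity and generator of the continuation value *)

Section ContinuationValue.
Variables (R : realType) (K1 k2 n1 n2 : R).
Hypotheses (kap0 : 0 < k2 - K1) (n10 : n1 < 0) (n20 : 0 < n2).

Local Notation C := ((k2 - K1) / (n2 - n1)).
Local Notation cont := (continuation_value K1 k2 n1 n2).

(** This and [continuation_curvature] are the first two derivatives of [continuation_value]; the
    common factor $Cn_1n_2$ is negative, which yields their signs. *)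
Definition continuation_slope (a x : R) : R :=
  C * (n1 * n2) * (expR (n1 * (x - a)) - expR (n2 * (x - a))).

Definition continuation_curvature (a x : R) : R :=
  C * (n1 * n2) * (n1 * expR (n1 * (x - a)) - n2 * expR (n2 * (x - a))).

Local Notation slope := continuation_slope.
Local Notation curv := continuation_curvature.

Let n210 : 0 < n2 - n1. Proof. by rewrite subr_gt0 (lt_trans n10). Qed.
Let C0 : 0 < C. Proof. by rewrite divr_gt0. Qed.
Let Cn : C * (n1 * n2) < 0. Proof. by rewrite pmulr_rlt0 ?C0 // nmulr_rlt0. Qed.

Lemma is_derive_expR_shift (n a x : R) :
  is_derive x (1 : R) (fun y => expR (n * (y - a))) (n * expR (n * (x - a))).
Proof. exact: (is_derive_shift_fun (is_derive_expRZ n (x - a))). Qed.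

Lemma is_derive_continuation a (x : R) : is_derive x (1 : R) (cont a) (slope a x).
Proof.
apply: is_derive_eq (is_deriveZ_fun C (is_deriveB_fun
  (is_deriveZ_fun n2 (is_derive_expR_shift n1 a x))
  (is_deriveZ_fun n1 (is_derive_expR_shift n2 a x)))) _.
rewrite /slope; ring.
Qed.

Lemma is_derive_slope a (x : R) : is_derive x (1 : R) (slope a) (curv a x).
Proof.
exact: (is_deriveZ_fun (C * (n1 * n2)) (is_deriveB_fun
  (is_derive_expR_shift n1 a x) (is_derive_expR_shift n2 a x))).
Qed.

Lemma curvature_continuous a : continuous (curv a).
Proof.
have d x := is_deriveZ_fun (C * (n1 * n2)) (is_deriveB_fun
  (is_deriveZ_fun n1 (is_derive_expR_shift n1 a x))
  (is_deriveZ_fun n2 (is_derive_expR_shift n2 a x))).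
exact: is_derive_continuous d.
Qed.

Lemma continuation_value_refl a : cont a a = k2 - K1.
Proof.
rewrite /continuation_value subrr !mulr0 !expR0 !mulr1 divfK //.
exact: lt0r_neq0.
Qed.

Lemma slope_refl a : slope a a = 0.
Proof. by rewrite /slope subrr !mulr0 subrr mulr0. Qed.

Lemma slope_lt0 a x : x < a -> slope a x < 0.
Proof.
move=> xa; rewrite /slope nmulr_rlt0 // subr_gt0 ltr_expR.
rewrite -subr_gt0 -mulrBl nmulr_rgt0 ?subr_lt0 //.
by rewrite (lt_trans n10).
Qed.

Lemma curvature_gt0 a x : 0 < curv a x.
Proof.
rewrite /curv nmulr_rgt0 // subr_lt0 (@lt_trans _ _ 0) //.
  by rewrite nmulr_rlt0 // expR_gt0.
by rewrite mulr_gt0 // expR_gt0.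
Qed.

Lemma slope_lt a x z : x < z -> slope a x < slope a z.
Proof.
by apply: is_derive_gt0_homo (is_derive_slope a) _ => t _; exact: curvature_gt0.
Qed.

Lemma continuation_value_lt a x z : x < z -> z <= a -> cont a z < cont a x.
Proof.
move=> xz za; rewrite -ltrN2.
apply: (@is_derive_gt0_homo _ (fun x => - cont a x) (fun x => - slope a x)) xz.
  by move=> t; have := is_derive_continuation a t; exact: is_deriveN.
by move=> t /andP[_ tz]; rewrite oppr_gt0 slope_lt0 // (lt_le_trans tz).
Qed.

Lemma continuation_value_ge a x : x <= a -> k2 - K1 <= cont a x.
Proof.
rewrite le_eqVlt => /predU1P[->|xa]; first by rewrite continuation_value_refl.
by rewrite -(continuation_value_refl a) ltW // continuation_value_lt.
Qed.

(* The graph of the continuation value moves away from the exercise value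
   [K - e^x] to the right of any point where it is at least as steep. *)
Lemma continuation_value_expR_lt a x0 x : - expR x0 <= slope a x0 -> x0 < x ->
  cont a x0 + expR x0 < cont a x + expR x.
Proof.
move=> h x0x.
apply: (@is_derive_gt0_homo _ (fun x => cont a x + expR x)
  (fun x => slope a x + expR x)) x0x.
  by move=> t; apply: is_deriveD_fun; exact: is_derive_continuation.
move=> t /andP[x0t _]; have := slope_lt a x0t.
have : expR x0 < expR t by rewrite ltr_expR.
lra.
Qed.

Lemma continuation_value_bound a x0 x : x0 <= x -> x <= a ->
  `|cont a x| <= cont a x0.
Proof.
move=> x0x xa; rewrite ger0_norm; last first.
  exact: le_trans (ltW kap0) (continuation_value_ge xa).
move: x0x; rewrite le_eqVlt => /predU1P[->//|x0x].
exact/ltW/continuation_value_lt.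
Qed.

(** Each exponential is annihilated, its exponent being a characteristic root. The form is pointwise
    because a candidate agrees with a continuation value only on part of the line. *)
Lemma generator_continuation (sigma r q : R) (DV D2V V : R -> R) a x :
  sigma ^+ 2 / 2 * n1 ^+ 2 + (r - q - sigma ^+ 2 / 2) * n1 - r = 0 ->
  sigma ^+ 2 / 2 * n2 ^+ 2 + (r - q - sigma ^+ 2 / 2) * n2 - r = 0 ->
  V x = cont a x -> DV x = slope a x -> D2V x = curv a x ->
  generator sigma r q V DV D2V x = 0.
Proof.
move=> h1 h2; rewrite /generator => -> -> ->.
rewrite /slope /curv /continuation_value.
set E1 := expR _; set E2 := expR _.
transitivity (C * n2 * E1 *
    (sigma ^+ 2 / 2 * n1 ^+ 2 + (r - q - sigma ^+ 2 / 2) * n1 - r)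
  - C * n1 * E2 *
    (sigma ^+ 2 / 2 * n2 ^+ 2 + (r - q - sigma ^+ 2 / 2) * n2 - r)).
  by ring.
by rewrite h1 h2; ring.
Qed.

End ContinuationValue.

(** * Roots of [f_tilde] and [g_tilde] in the logarithmic variable *)

Section Roots.
Variable R : realType.

Lemma continuous_addf (f g : R -> R) : continuous f -> continuous g ->
  continuous (fun x => f x + g x).
Proof. by move=> cf cg x; apply: cvgD; [exact: cf|exact: cg]. Qed.
Implicit Types (f phi dphi : R -> R) (x : R).

(** The substitution $z=e^x$ maps the negative half-line onto $(0,1)$; existence is the intermediate
    value theorem and uniqueness is strict decrease. *)
Lemma unique_root_exp f phi dphi (x0 : R) :
  (forall x, f (expR x) = phi x) ->
  (forall x : R, is_derive x (1 : R) phi (dphi x)) ->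
  (forall x, x < 0 -> dphi x < 0) -> phi 0 < 0 -> x0 <= 0 -> 0 <= phi x0 ->
  exists x, [/\ x < 0, phi x = 0 & unique_root_in01 f (expR x)].
Proof.
move=> fphi dp dp0 p0 x00 px0.
have cphi := continuous_subspaceT (is_derive_continuous dp) (A := `[x0, 0]).
have [|x] := @IVT _ phi x0 0 0 x00 cphi.
  by rewrite ge_min le_max (ltW p0) px0 orbT.
rewrite in_itv/= => /andP[_ x0'] phix.
have {x0'} xlt0 : x < 0.
  rewrite lt_neqAle x0' andbT; apply: contraTneq p0 => xE.
  by rewrite -{1}xE phix ltxx.
have decr x1 x2 : x1 < x2 -> x2 <= 0 -> phi x2 < phi x1.
  move=> x12 x20; rewrite -ltrN2.
  apply: (@is_derive_gt0_homo _ (fun x => - phi x) (fun x => - dphi x) _ _ _ _ x12).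
  by move=> t /andP[_ tx]; rewrite oppr_gt0 dp0 // (lt_le_trans tx).
exists x; split => //; split.
- by rewrite expR_gt0 expR_lt1.
- by rewrite fphi.
- move=> z /andP[z0 z1]; rewrite -[z]lnK ?posrE // fphi => phiz.
  have lz0 : ln z < 0 by apply: ln_lt0; rewrite z0.
  have [lzx|xlz|->//] := ltgtP (ln z) x.
    by have := decr _ _ lzx (ltW xlt0); rewrite phix phiz ltxx.
  by have := decr _ _ xlz (ltW lz0); rewrite phix phiz ltxx.
Qed.

(** A root thus says value minus slope equals $K_2+k_2-K_1$: this is value matching with the
    exercise value once the slope at the boundary is $-e^x$. *)
Lemma f_tildeE (K1 k2 K2 n1 n2 a x : R) : f_tilde K1 k2 K2 n1 n2 (expR (x - a)) =
  continuation_value K1 k2 n1 n2 a x - continuation_slope K1 k2 n1 n2 a x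
  - (K2 + k2 - K1).
Proof.
rewrite /f_tilde /continuation_value /continuation_slope -!expRM.
by rewrite !(mulrC (x - a)); ring.
Qed.

Lemma g_tildeE (K1 k2 K2 n1 n2 a x : R) : g_tilde K1 k2 K2 n1 n2 (expR (x - a)) =
  continuation_value K1 k2 n1 n2 a x - (K2 - K1).
Proof.
by rewrite /g_tilde /continuation_value -!expRM !(mulrC (x - a)).
Qed.

Lemma continuation_value_unbounded (K1 k2 n1 n2 K : R) :
  0 < k2 - K1 -> n1 < 0 -> 0 < n2 -> 0 < K ->
  exists2 x, x <= 0 & K <= continuation_value K1 k2 n1 n2 0 x.
Proof.
move=> kap0 n10 n20 K0.
pose C := (k2 - K1) / (n2 - n1).
have C0 : 0 < C by rewrite divr_gt0 // subr_gt0 (lt_trans n10).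
have Cn0 : 0 < C * n2 by rewrite mulr_gt0.
(* Here $e^{n_1x}=e^{K/(Cn_2)}\ge1+K/(Cn_2)$, so the first exponential term alone exceeds $K$; the
   other one is positive. *)
exists (K / (C * n2) / n1).
  by rewrite ler_ndivrMr // mul0r divr_ge0 // ltW.
rewrite /continuation_value -/C subr0 [n1 * (_ / n1)]mulrC divfK ?lt_eqF //.
set E2 := expR (n2 * _).
have E20 : 0 < - n1 * E2 by rewrite mulr_gt0 ?expR_gt0 ?oppr_gt0.
have h := expR_ge1Dx (K / (C * n2)).
have : C * n2 * (1 + K / (C * n2)) <= C * n2 * expR (K / (C * n2)).
  by rewrite ler_pM2l.
rewrite mulrDr mulr1 [_ * (K / _)]mulrC divfK ?gt_eqF // mulrBr mulrA => h1.
have : 0 < C * (- n1 * E2) by rewrite mulr_gt0.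
by rewrite mulNr mulrN => h2; lra.
Qed.

End Roots.

(** * The candidates solve the obstacle problem *)

Section PutSolutions.
Variables (R : realType) (K1 k2 K2 sigma r q p n1 n2 : R).
Hypotheses (kap0 : 0 < k2 - K1) (n10 : n1 < 0) (n20 : 0 < n2).
Hypotheses (s0 : 0 < sigma) (r0 : 0 < r) (q0 : 0 <= q) (p0 : 0 <= p).
Hypothesis root1 :
  sigma ^+ 2 / 2 * n1 ^+ 2 + (r - q - sigma ^+ 2 / 2) * n1 - r = 0.
Hypothesis root2 :
  sigma ^+ 2 / 2 * n2 ^+ 2 + (r - q - sigma ^+ 2 / 2) * n2 - r = 0.

Local Notation cont := (continuation_value K1 k2 n1 n2).
Local Notation slope := (continuation_slope K1 k2 n1 n2).
Local Notation curv := (continuation_curvature K1 k2 n1 n2).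
Local Notation psi := (psi2 K1 k2 K2).

Lemma psi2_le (x v : R) : k2 - K1 <= v -> K2 + k2 - K1 <= v + expR x -> psi x <= v.
Proof. by move=> h1 h2; rewrite /psi2; case: (leP (K2 - expR x) 0) => _; lra. Qed.

Lemma right_part_le (b x : R) (f : R -> R) : x <= b -> right_part b f x = 0.
Proof. by rewrite /right_part => ->. Qed.

Lemma right_part_gt (b x : R) (f : R -> R) : b < x -> right_part b f x = f x.
Proof. by rewrite /right_part leNgt => ->. Qed.

Lemma is_derive_oppr_continuation (a x : R) :
  is_derive x (1 : R) (fun y => (k2 - K1) - cont a y) (- slope a x).
Proof.
apply: is_derive_eq (is_deriveB_fun (is_derive_cst (k2 - K1) x 1)
  (is_derive_continuation K1 k2 n1 n2 a x)) _.
by rewrite sub0r.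
Qed.

Lemma is_derive_oppr_slope (a x : R) :
  is_derive x (1 : R) (fun y => - slope a y) (- curv a x).
Proof. by have := is_derive_slope K1 k2 n1 n2 a x; exact: is_deriveN. Qed.

Lemma oppr_curvature_continuous a : continuous (fun x => - curv a x).
Proof. by move=> x; apply: cvgN; exact: curvature_continuous. Qed.

Lemma V_tildeE (a : R) : V_tilde K1 k2 n1 n2 a =
  (fun x => cont a x + right_part a (fun y => (k2 - K1) - cont a y) x).
Proof.
apply/funext => x; rewrite /V_tilde /right_part; case: ifP => _; first by rewrite addr0.
by ring.
Qed.

(** The hypotheses put the continuation value above the exercise value at the left end [c], with at
    least its slope, so convexity keeps it above; at [a] this gives $K_2\le e^a$, hence a constant
    obstacle from there on. *)
Lemma V_tilde_solution (a c : R) : c < a -> - expR c <= slope a c ->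
  K2 + k2 - K1 <= cont a c + expR c ->
  strong_obstacle_solution sigma r q p `[c, +oo[ `]c, +oo[ psi
    (V_tilde K1 k2 n1 n2 a).
Proof.
move=> ca sc Kc.
have kapgt0 := kap0.
have Ka x : a <= x -> K2 <= expR x.
  move=> ax; apply: (@le_trans _ _ (expR a)); last by rewrite ler_expR.
  have := continuation_value_expR_lt kap0 n10 n20 sc ca.
  by rewrite continuation_value_refl //; lra.
pose DV x := slope a x + right_part a (fun y => - slope a y) x.
pose D2V x := curv a x + right_part a (fun y => - curv a y) x.
have cont_a : (k2 - K1) - cont a a = 0 by rewrite continuation_value_refl // subrr.
apply: (@regular_strong_obstacle_solution _ _ _ _ _ a a _ _ _ _ DV D2V) => //.
- apply: (@bounded_onP _ _ _ (cont a c)) => x; rewrite /= in_itv/= andbT => cx.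
  rewrite /V_tilde; case: ifP => xa; first exact: continuation_value_bound.
  by rewrite ger0_norm ?(ltW kap0) // continuation_value_ge // ltW.
- rewrite V_tildeE; apply: continuous_addf.
    exact: (is_derive_continuous (is_derive_continuation K1 k2 n1 n2 a)).
  apply: right_part_continuous => //.
  exact: (is_derive_continuous (is_derive_oppr_continuation a)).
- move=> x; rewrite /= in_itv/= andbT => cx; apply: psi2_le.
    by rewrite /V_tilde; case: ifP => // xa; exact: continuation_value_ge.
  rewrite /V_tilde; case: ifPn => [_|]; last first.
    by rewrite -ltNge => /ltW/Ka; lra.
  move: cx; rewrite le_eqVlt => /predU1P[<-//|cx].
  by rewrite (le_trans Kc) // ltW // continuation_value_expR_lt.
- rewrite V_tildeE; apply: regular_W2D.
    exact: (regular_W2_C2 (is_derive_continuation _ _ _ _ a) (is_derive_slope _ _ _ _ a)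
      (@curvature_continuous _ _ _ _ _ a)).
  apply: (regular_W2_right_part (is_derive_oppr_continuation a)
    (is_derive_oppr_slope a)) => //.
    exact: oppr_curvature_continuous.
  by rewrite slope_refl oppr0.
- move=> x _ xa _; have [xlta|alta] := ltP x a.
    have -> : generator sigma r q (V_tilde K1 k2 n1 n2 a) DV D2V x = 0; last by [].
    apply: (generator_continuation (a := a) root1 root2).
    + by rewrite /V_tilde ltW.
    + by rewrite /DV right_part_le ?addr0 // ltW.
    + by rewrite /D2V right_part_le ?addr0 // ltW.
  have ax : a < x by rewrite lt_neqAle eq_sym xa.
  have Vx : V_tilde K1 k2 n1 n2 a x = k2 - K1 by rewrite /V_tilde leNgt ax.
  (* Past [a] the candidate coincides with the obstacle, so the equality clause is vacuous. *)
  split; last first.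
    rewrite Vx /psi2; have := Ka x (ltW ax).
    by case: (leP (K2 - expR x) 0) => h1 h2 h3; lra.
  rewrite /generator Vx /DV /D2V !right_part_gt // !subrr !mulr0 !add0r.
  by rewrite oppr_le0 mulr_ge0 // ltW.
Qed.


Lemma V_tilde_inftyE (b a : R) : b < a -> cont a b + expR b = K2 + k2 - K1 ->
  V_tilde_infty K1 k2 K2 n1 n2 b a = (fun x =>
    ((K2 + k2 - K1) - expR x) +
    right_part b (fun y => cont a y + expR y - (K2 + k2 - K1)) x +
    right_part a (fun y => (k2 - K1) - cont a y) x).
Proof.
move=> ba Vb; apply/funext => x; rewrite /V_tilde_infty.
have [xb|] := ltP x b.
  by rewrite !right_part_le ?addr0; [ring|rewrite ltW// (lt_trans xb)|rewrite ltW].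
rewrite le_eqVlt => /predU1P[<-|bx].
  by rewrite (ltW ba) !right_part_le ?lexx ?(ltW ba) //; lra.
rewrite (right_part_gt _ bx); case: ifPn => xa; first by rewrite right_part_le //; ring.
by rewrite right_part_gt ?ltNge //; ring.
Qed.

(** At [b] the matched value exceeds the constant $k_2-K_1$ by strict decrease; at [a] the constant
    exceeds the exercise value by convexity. *)
Lemma free_boundaries (b a : R) : b < a -> slope a b = - expR b ->
  cont a b + expR b = K2 + k2 - K1 -> expR b < K2 < expR a.
Proof.
move=> ba Sb Vb; apply/andP; split.
  have := continuation_value_lt kap0 n10 n20 ba (lexx a).
  by rewrite continuation_value_refl //; lra.
have sb : - expR b <= slope a b by rewrite Sb.
have := continuation_value_expR_lt kap0 n10 n20 sb ba.
by rewrite continuation_value_refl //; lra.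
Qed.

(* Comparing the one-sided second derivatives at [b] bounds the generator of
   the exercise value there. *)
Lemma exercise_generator_le0 (b a x : R) : slope a b = - expR b ->
  cont a b + expR b = K2 + k2 - K1 -> x <= b -> q * expR x <= r * (K2 + k2 - K1).
Proof.
move=> Sb Vb xb.
have := @generator_continuation _ K1 k2 n1 n2 sigma r q (slope a) (curv a) (cont a)
  a b root1 root2 erefl erefl erefl.
rewrite /generator Sb.
have s2 : 0 < sigma ^+ 2 / 2 by rewrite divr_gt0 // exprn_gt0.
have : 0 < sigma ^+ 2 / 2 * curv a b by rewrite mulr_gt0 // curvature_gt0.
have : 0 < sigma ^+ 2 / 2 * expR b by rewrite mulr_gt0 // expR_gt0.
have : q * expR x <= q * expR b by rewrite ler_wpM2l // ler_expR.
rewrite (_ : cont a b = K2 + k2 - K1 - expR b); last by lra.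
rewrite mulrN !mulrBl mulrBr; lra.
Qed.

(** Leaving [D] and [O] free covers the problem on the line and its restriction to $[\ln
    k_2,\infty)$ together. *)
Lemma V_tilde_infty_solution (b a : R) (D O : set R) : open O -> b < a ->
  slope a b = - expR b -> cont a b + expR b = K2 + k2 - K1 ->
  strong_obstacle_solution sigma r q p D O psi (V_tilde_infty K1 k2 K2 n1 n2 b a).
Proof.
move=> oO ba Sb Vb.
have [bK Ka] := andP (free_boundaries ba Sb Vb); have kapgt0 := kap0.
have sb : - expR b <= slope a b by rewrite Sb.
have dcE (x : R) : is_derive x (1 : R) (fun y => cont a y + expR y - (K2 + k2 - K1))
    (slope a x + expR x).
  apply: is_derive_eq (is_deriveB_fun (is_deriveD_fun
    (is_derive_continuation K1 k2 n1 n2 a x) (is_derive_expR x))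
    (is_derive_cst (K2 + k2 - K1) x 1)) _.
  by rewrite subr0.
have dsE (x : R) : is_derive x (1 : R) (fun y => slope a y + expR y)
    (curv a x + expR x).
  exact: is_deriveD_fun (is_derive_slope K1 k2 n1 n2 a x) (is_derive_expR x).
have dE (x : R) : is_derive x (1 : R) (fun y => (K2 + k2 - K1) - expR y) (- expR x).
  apply: is_derive_eq (is_deriveB_fun (is_derive_cst (K2 + k2 - K1) x 1)
    (is_derive_expR x)) _.
  by rewrite sub0r.
have d2E (x : R) : is_derive x (1 : R) (fun y => - expR y) (- expR x).
  by have := is_derive_expR x; exact: is_deriveN.
pose DV x := - expR x + right_part b (fun y => slope a y + expR y) x +
  right_part a (fun y => - slope a y) x.
pose D2V x := - expR x + right_part b (fun y => curv a y + expR y) x +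
  right_part a (fun y => - curv a y) x.
have cont_a : (k2 - K1) - cont a a = 0 by rewrite continuation_value_refl // subrr.
have cont_b : cont a b + expR b - (K2 + k2 - K1) = 0 by rewrite Vb subrr.
apply: (@regular_strong_obstacle_solution _ _ _ _ _ a b _ _ _ _ DV D2V) => //.
- apply: (@bounded_onP _ _ _ (K2 + k2 - K1)) => x _; rewrite /V_tilde_infty.
  have eb := expR_gt0 b; have ex := expR_gt0 x.
  have [xb|bx] := ltP x b.
    have : expR x < expR b by rewrite ltr_expR.
    by move=> exb; rewrite ger0_norm; lra.
  case: ifP => xa.
    by rewrite (le_trans (continuation_value_bound _ _ _ bx xa)) //; lra.
  by rewrite ger0_norm; lra.
- rewrite V_tilde_inftyE //; apply: continuous_addf; first apply: continuous_addf.
  + exact: (is_derive_continuous dE).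
  + by apply: right_part_continuous => //; exact: (is_derive_continuous dcE).
  + apply: right_part_continuous => //.
    exact: (is_derive_continuous (is_derive_oppr_continuation a)).
- move=> x _; rewrite /V_tilde_infty; have [xb|bx] := ltP x b.
    have : expR x < expR b by rewrite ltr_expR.
    by move=> exb; apply: psi2_le; lra.
  case: ifPn => xa; last first.
    have : expR a < expR x by rewrite ltr_expR ltNge.
    by move=> eax; apply: psi2_le; lra.
  apply: psi2_le; first exact: continuation_value_ge.
  move: bx; rewrite le_eqVlt => /predU1P[<-|bx]; first by rewrite Vb.
  by rewrite -Vb ltW // continuation_value_expR_lt.
- rewrite V_tilde_inftyE //; apply: regular_W2D; first apply: regular_W2D.
  + apply: (regular_W2_C2 dE d2E).
    exact: (is_derive_continuous d2E).
  + apply: (regular_W2_right_part dcE dsE) => //; last by rewrite Sb addNr.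
    by move=> x; apply: cvgD; [exact: curvature_continuous|exact: continuous_expR].
  + apply: (regular_W2_right_part (is_derive_oppr_continuation a)
    (is_derive_oppr_slope a)) => //.
      exact: oppr_curvature_continuous.
    by rewrite slope_refl oppr0.
- move=> x _ xa xb; have [xltb|bltx] := ltP x b.
    have xlta : x < a by exact: lt_trans ba.
    have exb : expR x < expR b by rewrite ltr_expR.
    have Vx : V_tilde_infty K1 k2 K2 n1 n2 b a x = K2 - expR x + k2 - K1.
      by rewrite /V_tilde_infty xltb.
    split; last by rewrite Vx /psi2; case: (leP (K2 - expR x) 0) => h1 h2; lra.
    rewrite /generator Vx /DV /D2V !right_part_le ?(ltW xlta) ?(ltW xltb) // !addr0.
    (* The generator of the exercise value is $qe^x-r(K_2+k_2-K_1)$. *)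
    have := exercise_generator_le0 Sb Vb (ltW xltb).
    by rewrite !mulrN !mulrBl !mulrBr !mulrDr; lra.
  have {bltx} bx : b < x by rewrite lt_neqAle eq_sym xb.
  have [xlta|alta] := ltP x a.
    have -> : generator sigma r q (V_tilde_infty K1 k2 K2 n1 n2 b a) DV D2V x = 0;
      last by [].
    apply: (generator_continuation (a := a) root1 root2).
    + by rewrite /V_tilde_infty ltNge (ltW bx) /= ltW.
    + by rewrite /DV right_part_gt // right_part_le ?(ltW xlta) // addr0 addrC addrK.
    + by rewrite /D2V right_part_gt // right_part_le ?(ltW xlta) // addr0 addrC addrK.
  have ax : a < x by rewrite lt_neqAle eq_sym xa.
  have eax : expR a < expR x by rewrite ltr_expR.
  have Vx : V_tilde_infty K1 k2 K2 n1 n2 b a x = k2 - K1.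
    by rewrite /V_tilde_infty ltNge (ltW bx) /= leNgt ax.
  split; last by rewrite Vx /psi2; case: (leP (K2 - expR x) 0) => h1 h2; lra.
  rewrite /generator Vx /DV /D2V !right_part_gt //.
  rewrite (_ : - expR x + (curv a x + expR x) + - curv a x = 0); last by ring.
  rewrite (_ : - expR x + (slope a x + expR x) + - slope a x = 0); last by ring.
  by rewrite !mulr0 add0r sub0r oppr_le0 mulr_ge0 // ltW.
Qed.

End PutSolutions.

(** * Uniqueness for the capped problem, and determination of the free boundaries *)

Lemma capped_put_solution_unique (R : realType) (sigma r q K1 k2 K2 n1 n2 p : R)
    (V : R -> R) : 0 < sigma -> n1 < 0 -> 0 < n2 ->
  sigma ^+ 2 / 2 * n1 ^+ 2 + (r - q - sigma ^+ 2 / 2) * n1 - r = 0 ->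
  sigma ^+ 2 / 2 * n2 ^+ 2 + (r - q - sigma ^+ 2 / 2) * n2 - r = 0 ->
  capped_put_solution sigma r q K1 k2 K2 p V ->
  unique_capped_put_solution sigma r q K1 k2 K2 p V.
Proof.
move=> s0 n10 n20 root1 root2 capV; split => // W [solW Wk]; have [solV Vk] := capV.
have [vS vP] := vieta (lt_trans n10 n20) root1 root2.
move=> x; rewrite in_itv/= andbT => kx; apply/eqP; rewrite eq_le.
apply/andP; split.
  by apply: (strong_obstacle_solution_le s0 n10 n20 vS vP solW solV) kx; rewrite Vk Wk.
by apply: (strong_obstacle_solution_le s0 n10 n20 vS vP solV solW) kx; rewrite Vk Wk.
Qed.

(** Only the signed distance to the boundary matters, so the free-boundary equations are solved with
    the boundary at 0 and then translated. *)
Lemma continuation_value_translate (R : realType) (K1 k2 n1 n2 x t : R) :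
  continuation_value K1 k2 n1 n2 (x - t) x = continuation_value K1 k2 n1 n2 0 t.
Proof. by rewrite /continuation_value subr0 (_ : x - (x - t) = t) //; ring. Qed.

Lemma continuation_slope_translate (R : realType) (K1 k2 n1 n2 x t : R) :
  continuation_slope K1 k2 n1 n2 (x - t) x = continuation_slope K1 k2 n1 n2 0 t.
Proof. by rewrite /continuation_slope subr0 (_ : x - (x - t) = t) //; ring. Qed.

Theorem theorem5p6 (R : realType) (K1 k1 k2 K2 sigma r q p n1 n2 : R)
  (hK1 : 0 < K1) (hK1k1 : K1 < k1) (hk1k2 : k1 < k2) (hk2K2 : k2 < K2)
  (hsigma : 0 < sigma) (hr : 0 < r) (hq : 0 <= q) (hp : 1 < p)
  (hn1 : n1 < 0) (hn2 : 0 < n2)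
  (hroot1 : sigma ^+ 2 / 2 * n1 ^+ 2 + (r - q - sigma ^+ 2 / 2) * n1 - r = 0)
  (hroot2 : sigma ^+ 2 / 2 * n2 ^+ 2 + (r - q - sigma ^+ 2 / 2) * n2 - r = 0) :
  exists y b a : R,
    [/\ unique_root_in01 (f_tilde K1 k2 K2 n1 n2) y,
        expR b = - ((k2 - K1) * n1 * n2 / (n2 - n1)) * (y `^ n1 - y `^ n2),
        expR a = expR b / y &
        b < a] /\
    [/\ b < ln K2 < a,
        uncapped_put_solution sigma r q K1 k2 K2 p
          (V_tilde_infty K1 k2 K2 n1 n2 b a),
        ln k2 <= b ->
          unique_capped_put_solution sigma r q K1 k2 K2 p
            (V_tilde_infty K1 k2 K2 n1 n2 b a) &
        b < ln k2 ->
          exists yc ac : R,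
            [/\ unique_root_in01 (g_tilde K1 k2 K2 n1 n2) yc,
                expR ac = k2 / yc,
                forall a', V_tilde K1 k2 n1 n2 a' (ln k2) = K2 - K1 <-> a' = ac
              & unique_capped_put_solution sigma r q K1 k2 K2 p
                  (V_tilde K1 k2 n1 n2 ac)]].
Proof.
have kap0 : 0 < k2 - K1 by lra.
have k20 : 0 < k2 by lra.
have p0 : 0 <= p by lra.
have ek2 : expR (ln k2) = k2 by rewrite lnK ?posrE.
pose cont := continuation_value K1 k2 n1 n2.
pose slope := continuation_slope K1 k2 n1 n2.
pose curv := continuation_curvature K1 k2 n1 n2.
have cont00 : cont 0 0 = k2 - K1 by exact: continuation_value_refl.
have slope_le0 x : x <= 0 -> slope 0 x <= 0.
  rewrite le_eqVlt => /predU1P[->|x0]; first by rewrite /slope slope_refl.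
  by apply/ltW/slope_lt0.
(* [t] is $\ln\widetilde y=\widetilde b-\widetilde a$. *)
have [t [t0 ft fy]] : exists t, [/\ t < 0, cont 0 t - slope 0 t - (K2 + k2 - K1) = 0 &
    unique_root_in01 (f_tilde K1 k2 K2 n1 n2) (expR t)].
  have [|x0 x00 hx0] :=
    @continuation_value_unbounded _ K1 k2 n1 n2 (K2 + k2 - K1) kap0 hn1 hn2.
    by lra.
  apply: (@unique_root_exp _ _ (fun x => cont 0 x - slope 0 x - (K2 + k2 - K1))
    (fun x => slope 0 x - curv 0 x - 0) x0) => //.
  - by move=> x; rewrite -[in LHS](subr0 x) f_tildeE.
  - move=> x; exact: (is_deriveB_fun (is_deriveB_fun
      (is_derive_continuation K1 k2 n1 n2 0 x) (is_derive_slope K1 k2 n1 n2 0 x))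
      (is_derive_cst (K2 + k2 - K1) x 1)).
  - move=> x x0lt; rewrite subr0 subr_lt0 (@lt_trans _ _ 0) //; first exact: slope_lt0.
    exact: curvature_gt0.
  - by rewrite cont00 /slope slope_refl; lra.
  - by have := slope_le0 _ x00; move: hx0; rewrite -/cont; lra.
have st0 : 0 < - slope 0 t by rewrite oppr_gt0; exact: slope_lt0.
(* This [b] makes the slope at [b] equal to $-e^b$, which is smooth fit; the equation for [t] then
   becomes value matching. *)
pose b := ln (- slope 0 t); pose a := b - t.
have eb : expR b = - slope 0 t by rewrite lnK ?posrE.
have ba : b < a by rewrite /a; lra.
have Sb : slope a b = - expR b by rewrite eb opprK; exact: continuation_slope_translate.
have Vb : cont a b + expR b = K2 + k2 - K1.
  by rewrite eb /cont continuation_value_translate -/cont; lra.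
exists (expR t), b, a; split; first split => //.
- by rewrite eb /slope /continuation_slope subr0 -!expRM !(mulrC t); ring.
- by rewrite /a expRB.
have [bK Ka] := andP (free_boundaries kap0 hn1 hn2 ba Sb Vb).
have sol (D O : set R) (oO : open O) := V_tilde_infty_solution kap0 hn1 hn2
  hsigma hr hq p0 hroot1 hroot2 D oO ba Sb Vb.
split.
- by rewrite -ltr_expR -[_ < a]ltr_expR lnK ?bK // posrE; lra.
- exact/sol/openT.
- move=> kb; apply: (capped_put_solution_unique hsigma hn1 hn2 hroot1 hroot2).
  split; first by apply: sol; exact: interval_open.
  (* When [b = ln k2] the boundary point falls in the continuation branch, and value matching
     supplies $K_2-K_1$. *)
  rewrite /V_tilde_infty; move: kb; rewrite le_eqVlt => /predU1P[kb|->]; last first.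
    by rewrite ek2; ring.
  have ebk : expR b = k2 by rewrite -kb.
  by rewrite kb ltxx (ltW ba) -/(cont a b); lra.
move=> bk.
have ebk : expR b < k2 by rewrite -ek2 ltr_expR.
have [tc [tc0 gtc gy]] : exists t, [/\ t < 0, cont 0 t - (K2 - K1) = 0 &
    unique_root_in01 (g_tilde K1 k2 K2 n1 n2) (expR t)].
  have [|x0 x00 hx0] :=
    @continuation_value_unbounded _ K1 k2 n1 n2 (K2 - K1) kap0 hn1 hn2.
    by lra.
  apply: (@unique_root_exp _ _ (fun x => cont 0 x - (K2 - K1))
    (fun x => slope 0 x - 0) x0) => //.
  - by move=> x; rewrite -[in LHS](subr0 x) g_tildeE.
  - move=> x; exact: (is_deriveB_fun (is_derive_continuation K1 k2 n1 n2 0 x)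
      (is_derive_cst (K2 - K1) x 1)).
  - by move=> x x0lt; rewrite subr0; exact: slope_lt0.
  - by rewrite cont00; lra.
  - by rewrite subr_ge0.
have cont_tc : cont 0 tc = K2 - K1 by lra.
(* As $e^b<k_2$, the value at [t] is $K_2+k_2-K_1-e^b>K_2-K_1$, and the value decreases. By
   convexity the slope at [tc] then exceeds $-e^b>-k_2$, as [V_tilde_solution] requires. *)
have ttc : t < tc.
  rewrite ltNge; apply/negP; rewrite le_eqVlt => /predU1P[E|tct].
    by move: ft cont_tc; rewrite E; lra.
  have := continuation_value_lt kap0 hn1 hn2 tct (ltW t0).
  by rewrite -/(cont 0 t) -/(cont 0 tc); lra.
have cac : ln k2 < ln k2 - tc by lra.
have Vac : cont (ln k2 - tc) (ln k2) = K2 - K1.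
  by rewrite /cont continuation_value_translate.
exists (expR tc), (ln k2 - tc); split => //.
- by rewrite expRB ek2.
- move=> a'; split => [|->]; last by rewrite /V_tilde (ltW cac).
  (* For [a' < ln k2] the value would be $k_2-K_1$, different from $K_2-K_1$; otherwise strict
     decrease determines [ln k2 - a']. *)
  rewrite /V_tilde; case: ifPn => [ka'|_ E]; last by exfalso; lra.
  rewrite -[in LHS](subKr (ln k2) a') continuation_value_translate => E.
  have ka0 : ln k2 - a' <= 0 by rewrite subr_le0.
  have [lt1|lt1|<-] := ltgtP (ln k2 - a') tc; last by rewrite subKr.
    have := continuation_value_lt kap0 hn1 hn2 lt1 (ltW tc0).
    by rewrite E -/(cont 0 tc); lra.
  by have := continuation_value_lt kap0 hn1 hn2 lt1 ka0; rewrite E -/(cont 0 tc); lra.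
- apply: (capped_put_solution_unique hsigma hn1 hn2 hroot1 hroot2).
  split; last by rewrite /V_tilde (ltW cac).
  apply: V_tilde_solution => //.
    rewrite ek2 continuation_slope_translate.
    by have := slope_lt kap0 hn1 hn2 0 ttc; rewrite -/(slope 0 t); lra.
  by rewrite -/(cont _ _) Vac ek2; lra.
Qed.
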